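(* Let $f=\max_k f_k:P^+\to\mathbb{R}_+$ be the control objective function of the stochastic power system described in the context, let $p_s\in P^+$, and let $v\in\mathbb{R}^{n^+-1}$ be such that $p_s+v\in P^+$. Write $I_{max}(p_s)=\{k\in\mathbb{Z}_{n_E}: f_k(p_s)=f(p_s)\}$ and $I_{max}(p_s,v)=\{k\in I_{max}(p_s): f'(p_s,v)=f_k'(p_s,v)\}$. (a) If $I_{max}(p_s)=\{k\}$ and $A(k)p_s+b_k\neq0$, then the second directional derivative of $f$ at $p_s$ in the direction $v$ exists and $$f''(p_s,v)=f_k''(p_s,v)=\big(1-(A(k)p_s+b_k)^2\big)^{-3/2}\,|A(k)p_s+b_k|\;v^\top A(k)^\top A(k)v+r\,v^\top\nabla^2\sigma_k(p_s)v.$$ (b) If $I_{max}(p_s)=\{k\}$ and $A(k)p_s+b_k=0$, then the second directional derivative of $f$ at $p_s$ in the direction $v$ exists and $$f''(p_s,v)=f_k''(p_s,v)=r\,v^\top\nabla^2\sigma_k(p_s)v.$$ (c) If $I_{max}(p_s)$ has two or more elements, then the second directional derivative of $f$ at $p_s$ in the direction $v$ exists and $$\tfrac12 f''(p_s,v)=\tfrac12\max_{k\in I_{max}(p_s,v)}f_k''(p_s,v),$$ where $f_k''(p_s,v)$ is given by the expression in (a) or in (b) according to whether $A(k)p_s+b_k$ is nonzero or zero.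
   Context: The first directional derivative is $g'(x,v)=\lim_{\tau\downarrow0}\frac{g(x+\tau v)-g(x)}{\tau}$ and the second directional derivative $g''(x,v)$ is defined by $\frac12 g''(x,v)=\lim_{\tau\downarrow0}\frac{g(x+\tau v)-g(x)-\tau g'(x,v)}{\tau^2}$, when these limits exist. Functions on $P^+$ are understood to be given by the same formulas on an open neighborhood of $P^+$, so derivatives make sense at boundary points. $\mathbb{R}_+$ denotes the nonnegative reals, $\mathbb{Z}_n=\{1,\dots,n\}$, $A(k)$ is the $k$-th row of the matrix $A$, and $e_i$ is the $i$-th unit vector. Network data: a connected graph $G=(V,E)$ with $n_V$ vertices and $n_E$ edges and incidence matrix $B\in\mathbb{R}^{n_V\times n_E}$ (for the $k$-th edge $(i_k,j_k)$ the $k$-th column has $+1$ in row $i_k$, $-1$ in row $j_k$, zeros elsewhere); diagonal matrices $M\in\mathbb{R}^{n_V\times n_V}$ (strictly positive diagonal), $D\in\mathbb{R}^{n_V\times n_V}$ (nonnegative diagonal), $K_2\in\mathbb{R}^{n_V\times n_V}$ (nonnegative diagonal), $W\in\mathbb{R}^{n_E\times n_E}$ (strictly positive diagonal). Vertices $1,\dots,n^+$ ($n^+\ge 2$) are power supply nodes, vertices $n^++1,\dots,n_V$ are demand nodes. Given are $p^{+,max}\in\mathbb{R}_+^{n^+}$, $p^-\in\mathbb{R}_+^{n_V-n^+}$ with $p^-_{sum}=\sum_i p_i^->0$ and $\sum_{i=1}^{n^+}p_i^{+,max}\ge p^-_{sum}$, and a parameter $r>0$. Domain: $P^+=\{p_s\in\mathbb{R}_+^{n^+-1}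 : b_1\le A_1p_s,\ p_s\le b_2\}$ (componentwise), where $b_1(i)=p_{sum}^--p_{n^+}^{+,max}-\cdots-p_{i+1}^{+,max}$, $b_2(i)=p_i^{+,max}$, and $A_1\in\mathbb{R}^{(n^+-1)\times(n^+-1)}$ has $A_1(i,j)=1$ if $i\ge j$ and $0$ otherwise. Let $L=BWB^\top$ with Moore–Penrose inverse $L^\dagger$, $A=B^\top L^\dagger[e_1-e_{n^+},\dots,e_{n^+-1}-e_{n^+}]\in\mathbb{R}^{n_E\times(n^+-1)}$, $b=B^\top L^\dagger[e_{n^++1}-e_{n^+},\dots,e_{n_V}-e_{n^+}](-p^-)\in\mathbb{R}^{n_E}$. Standing assumption: $|A(k)p_s+b_k|<1$ for all $p_s\in P^+$, $k\in\mathbb{Z}_{n_E}$. Set $f_{as,k}(p_s)=\arcsin(|A(k)p_s+b_k|)$. Standard deviations: let $W(p_s)=W\,\mathrm{diag}(\cos(\arcsin(Ap_s+b)))$ and let $U(p_s)\in\mathbb{R}^{n_V\times n_V}$ be orthogonal such that $U(p_s)^\top M^{-1/2}BW(p_s)B^\top M^{-1/2}U(p_s)$ is diagonal with first diagonal entry $0$. For a matrix $X$ with $n_V$ columns let $X([2:n_V])$ be the matrix of its columns $2,\dots,n_V$. Put (writing $U=U(p_s)$) $$J_d(p_s)=\begin{bmatrix}0_{(n_V-1)\times(n_V-1)} & [\,0_{(n_V-1)\times1}\ \ I_{n_V-1}\,]\\ -(U^\top M^{-1/2}BW(p_s)B^\top M^{-1/2}U)([2:n_V]) & -U^\top M^{-1}DU\end{bmatrix},$$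 $$K_d(p_s)=\begin{bmatrix}0_{(n_V-1)\times n_V}\\ U^\top M^{-1/2}K_2\end{bmatrix},\quad C_d(p_s)=[\,(B^\top M^{-1/2}U)([2:n_V])\ \ 0_{n_E\times n_V}\,].$$ Standing assumption: $J_d(p_s)$ is Hurwitz for all $p_s\in P^+$. Let $Q(p_s)$ be the unique solution of $J_dQ+QJ_d^\top+K_dK_d^\top=0$ and $\sigma_k(p_s)=\big((C_dQC_d^\top)(k,k)\big)^{1/2}$, assumed strictly positive on $P^+$. Control objective function: $f_k(p_s)=f_{as,k}(p_s)+r\,\sigma_k(p_s)$ and $f(p_s)=\max_{k\in\mathbb{Z}_{n_E}}f_k(p_s)$. *)

(* Defs.v *)
From HB Require Import structures.
From mathcomp Require Import all_boot all_order all_algebra.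
From mathcomp Require Import complex.
From mathcomp Require Import all_classical all_reals all_analysis.

Set Implicit Arguments.
Unset Strict Implicit.
Unset Printing Implicit Defensive.

Import Order.TTheory GRing.Theory Num.Theory.
Import numFieldNormedType.Exports.

Local Open Scope classical_set_scope.
Local Open Scope ring_scope.

(* In this file np = m.+2 is the number n^+ >= 2 of supply nodes, nd the number
   of demand nodes, so that the space of the p_s has dimension n^+ - 1 = m.+1
   and n_V = m.+2 + nd, n_V - 1 = m.+1 + nd.  Indices are 0-based. *)

(* One-sided directional derivatives.  [dderiv1] and [dderiv2] are meaningful
   only under [has_dderiv1] and [has_dderiv2] respectively. *)
Section DirectionalDerivatives.
Context {R : realType} {V : lmodType R}.
Implicit Types (g : V -> R) (x v : V).

Definition dquot1 g x v (t : R) : R := (g (x + t *: v) - g x) / t.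

Definition has_dderiv1 g x v : Prop := cvg (dquot1 g x v t @[t --> 0^'+]).

Definition dderiv1 g x v : R := lim (dquot1 g x v t @[t --> 0^'+]).

Definition dquot2 g x v (t : R) : R :=
  (g (x + t *: v) - g x - t * dderiv1 g x v) / t ^+ 2.

Definition has_dderiv2 g x v : Prop :=
  has_dderiv1 g x v /\ cvg (dquot2 g x v t @[t --> 0^'+]).

Definition dderiv2 g x v : R := 2 * lim (dquot2 g x v t @[t --> 0^'+]).

End DirectionalDerivatives.

Section Hessian.
Context {R : realType} {n : nat}.
Implicit Types (g : 'cV[R]_n -> R) (x v : 'cV[R]_n).

Definition unit_vec (i : 'I_n) : 'cV[R]_n := delta_mx i 0.

Definition has_hessian g x : Prop :=
  (\forall y \near x, forall j, derivable g y (unit_vec j)) /\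
  (forall i j, derivable (fun y => 'D_(unit_vec j) g y) x (unit_vec i)).

Definition hessian g x : 'M[R]_n :=
  \matrix_(i, j) 'D_(unit_vec i) (fun y => 'D_(unit_vec j) g y) x.

End Hessian.

(* Maximum of F over I; the value 0 for I = set0 is a dummy. *)
Definition finmax {R : realType} {n : nat} (I : {set 'I_n}) (F : 'I_n -> R) : R :=
  if [pick k in I] is Some k0 then \big[Num.max/F k0]_(k in I) F k else 0.

Definition moore_penrose {R : realType} {n q : nat}
    (L : 'M[R]_(n, q)) (X : 'M[R]_(q, n)) : Prop :=
  [/\ L *m X *m L = L, X *m L *m X = X,
      (L *m X)^T = L *m X & (X *m L)^T = X *m L].

Definition mp_inverse {R : realType} {n q : nat} (L : 'M[R]_(n, q)) :
  'M[R]_(q, n) := xget 0 [set X | moore_penrose L X].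

Definition hurwitz {R : realType} {n : nat} (J : 'M[R]_n) : Prop :=
  forall z : R[i],
    eigenvalue (map_mx (real_complex R) J) z -> complex.Re z < 0.

Record network (R : realType) (m nd nE : nat) := Network {
  adj : rel 'I_(m.+2 + nd) ;
  adj_sym : symmetric adj ;
  adj_irr : irreflexive adj ;
  adj_connected : forall i j, connect adj i j ;
  (* the edges of the graph, each listed once with a chosen orientation *)
  edge : 'I_nE -> 'I_(m.+2 + nd) * 'I_(m.+2 + nd) ;
  edge_adj : forall k, adj (edge k).1 (edge k).2 ;
  edge_enum : forall i j, adj i j ->
    exists! k, edge k = (i, j) \/ edge k = (j, i) ;
  (* diagonals of M, D, K_2 and W *)
  mass : 'rV[R]_(m.+2 + nd) ;
  mass_gt0 : forall i, 0 < mass 0 i ;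
  damping : 'rV[R]_(m.+2 + nd) ;
  damping_ge0 : forall i, 0 <= damping 0 i ;
  disturbance : 'rV[R]_(m.+2 + nd) ;
  disturbance_ge0 : forall i, 0 <= disturbance 0 i ;
  weight : 'rV[R]_nE ;
  weight_gt0 : forall k, 0 < weight 0 k ;
  (* p^{+,max} and p^- *)
  supply_max : 'cV[R]_m.+2 ;
  supply_max_ge0 : forall i, 0 <= supply_max i 0 ;
  demand : 'cV[R]_nd ;
  demand_ge0 : forall j, 0 <= demand j 0 ;
  demand_sum_gt0 : 0 < \sum_j demand j 0 ;
  supply_ge_demand : \sum_j demand j 0 <= \sum_i supply_max i 0
}.

Section PowerSystem.
Context {R : realType} {m nd nE : nat} (G : network R m nd nE).

Local Notation nV := (m.+2 + nd)%N.
Local Notation nV1 := (m.+1 + nd)%N.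
Local Notation vec := 'cV[R]_m.+1.

Implicit Types (p : vec) (k : 'I_nE).

Definition incidence : 'M[R]_(nV, nE) :=
  \matrix_(i, k) ((i == (edge G k).1)%:R - (i == (edge G k).2)%:R).

Definition Mmx : 'M[R]_nV := diag_mx (mass G).
Definition Mmx_isqrt : 'M[R]_nV :=
  diag_mx (map_mx (fun x : R => (Num.sqrt x)^-1) (mass G)).
Definition Dmx : 'M[R]_nV := diag_mx (damping G).
Definition K2mx : 'M[R]_nV := diag_mx (disturbance G).
Definition Wmx : 'M[R]_nE := diag_mx (weight G).

Definition demand_sum : R := \sum_j demand G j 0.

Definition b1 : vec :=
  \col_i (demand_sum - \sum_(j < m.+2 | (i < j)%N) supply_max G j 0).
Definition b2 : vec := \col_i supply_max G (widen_ord (leqnSn m.+1) i) 0.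
Definition A1 : 'M[R]_m.+1 := \matrix_(i, j) (j <= i)%N%:R.

Definition Pplus : set vec :=
  [set p : vec | forall i, [/\ 0 <= p i 0, b1 i 0 <= (A1 *m p) i 0 & p i 0 <= b2 i 0]].

(* Vertices 1, ..., n^+ - 1; vertex n^+; vertices n^+ + 1, ..., n_V. *)
Definition gen_node (j : 'I_m.+1) : 'I_nV :=
  lshift nd (widen_ord (leqnSn m.+1) j).
Definition slack_node : 'I_nV := lshift nd ord_max.
Definition demand_node (j : 'I_nd) : 'I_nV := rshift m.+2 j.

(* The matrix with columns e_(s j) - e_(n^+). *)
Definition node_diff (q : nat) (s : 'I_q -> 'I_nV) : 'M[R]_(nV, q) :=
  \matrix_(i, j) ((i == s j)%:R - (i == slack_node)%:R).

Definition laplacian : 'M[R]_nV := incidence *m Wmx *m incidence^T.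

Definition Amx : 'M[R]_(nE, m.+1) :=
  incidence^T *m mp_inverse laplacian *m node_diff gen_node.

Definition bvec : 'cV[R]_nE :=
  incidence^T *m mp_inverse laplacian *m node_diff demand_node *m - demand G.

Definition flow p : 'cV[R]_nE := Amx *m p + bvec.

Definition f_as k p : R := asin `|flow p k 0|.

Definition Wp p : 'M[R]_nE :=
  Wmx *m diag_mx (\row_k cos (asin (flow p k 0))).

Definition scaled_laplacian p : 'M[R]_nV :=
  Mmx_isqrt *m incidence *m Wp p *m incidence^T *m Mmx_isqrt.

Definition diagonalizes p (U : 'M[R]_nV) : Prop :=
  let S := U^T *m scaled_laplacian p *m U in
  [/\ U^T *m U = 1%:M, is_diag_mx S & S (ord0 : 'I_nV1.+1) (ord0 : 'I_nV1.+1) = 0].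

(* X([2:n_V]) *)
Definition tail_cols (q : nat) (X : 'M[R]_(q, nV)) : 'M[R]_(q, nV1) :=
  col' (ord0 : 'I_nV1.+1) X.

Definition Jd p (U : 'M[R]_nV) : 'M[R]_(nV1 + nV) :=
  block_mx
    0 (row_mx (0 : 'M[R]_(nV1, 1)) (1%:M : 'M[R]_nV1) : 'M[R]_(nV1, nV))
    (- tail_cols (U^T *m scaled_laplacian p *m U))
    (- (U^T *m invmx Mmx *m Dmx *m U)).

Definition Kd (U : 'M[R]_nV) : 'M[R]_(nV1 + nV, nV) :=
  col_mx 0 (U^T *m Mmx_isqrt *m K2mx).

Definition Cd (U : 'M[R]_nV) : 'M[R]_(nE, nV1 + nV) :=
  row_mx (tail_cols (incidence^T *m Mmx_isqrt *m U)) 0.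

(* The solution of the Lyapunov equation is unique as soon as Jd is Hurwitz. *)
Definition Qx p (U : 'M[R]_nV) : 'M[R]_(nV1 + nV) :=
  xget 0 [set Q | Jd p U *m Q + Q *m (Jd p U)^T + Kd U *m (Kd U)^T = 0].

(* U is a choice p |-> U(p) of diagonalizing matrices. *)
Section Objective.
Context (U : vec -> 'M[R]_nV) (r : R).

Definition sigma k p : R :=
  Num.sqrt ((Cd (U p) *m Qx p (U p) *m (Cd (U p))^T) k k).

Definition f_ k p : R := f_as k p + r * sigma k p.

Definition fobj p : R := finmax [set: 'I_nE] (fun k => f_ k p).

Definition Imax p : {set 'I_nE} := [set k | f_ k p == fobj p].

Definition Imax_dir p (v : vec) : {set 'I_nE} :=
  [set k in Imax p | dderiv1 fobj p v == dderiv1 (f_ k) p v].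

(* The right-hand sides for a nonzero and for a zero component of the flow. *)
Definition d2_zero k p (v : vec) : R :=
  r * (v^T *m hessian (sigma k) p *m v) 0 0.

Definition d2_nonzero k p (v : vec) : R :=
  (1 - flow p k 0 ^+ 2) `^ (- (3 / 2)) * `|flow p k 0|
    * (v^T *m (row k Amx)^T *m row k Amx *m v) 0 0
  + r * (v^T *m hessian (sigma k) p *m v) 0 0.

End Objective.
End PowerSystem.

(* Main.v *)
Require Import Defs.
From HB Require Import structures.
From mathcomp Require Import all_boot all_order all_algebra.
From mathcomp Require Import complex.
From mathcomp Require Import all_classical all_reals all_analysis.
From mathcomp Require Import ring lra.
Import Order.TTheory GRing.Theory Num.Theory.
Import numFieldNormedType.Exports.
Local Open Scope classical_set_scope.
Local Open Scope ring_scope.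

(* At a point p of P+ every sigma_k is twice differentiable, although U need not
   even be continuous: connectedness of the graph makes the kernel of the scaled
   Laplacian a fixed line, so U(y) = U(p) W with W orthogonal and block diagonal,
   W conjugates the Lyapunov equations of U(y) and U(p), and the variances agree.
   With U(p) fixed, the solution of the Lyapunov equation is a rational function
   of the entries of J_d near p, because a Hurwitz matrix has an invertible
   Lyapunov operator.  Hence f_k has a one-sided expansion
   f_k(p) + t c_k + t^2 d_k + o(t^2) along v; for flow zero the arcsine of
   |t w| = t |w| contributes no quadratic term.  The maximum of finitely many such
   functions is governed by the lexicographically largest triples
   (f_k(p), c_k, d_k). *)

Set Implicit Arguments.
Unset Strict Implicit.
Unset Printing Implicit Defensive.

(** * Differentiability as a property of germs *)

Section NearDifferentiable.
Context {R : realFieldType} {V W : normedModType R}.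
Implicit Types (f g : V -> W) (x : V).

(** The differential is selected by a choice operator, so a candidate has to be exhibited: the zero
    map works because the remainder vanishes near [x]. *)
Lemma near0_differentiable f x : (\forall y \near x, f y = 0) -> differentiable f x.
Proof.
move=> f0; apply/diffP.
apply: (@getPex _ (fun (df : {linear V -> W}) => continuous df /\
  forall y, f y = f (lim (nbhs x)) + df (y - lim (nbhs x))
                  +o_(y \near x) (y - lim (nbhs x)))).
exists (\0 : {linear V -> W}); split; first by move=> y; apply: cst_continuous.
rewrite lim_id //.
suff: f = cst (f x) +o_ x (center x).
  by rewrite funeqE => fE y; rewrite /= addr0; exact: fE.
apply/eqaddoP => e e0.
near=> z; rewrite !fctE /= (nbhs_singleton f0) subr0.
by rewrite (near f0 z) // normr0 mulr_ge0 // ltW.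
Unshelve. all: by end_near. Qed.

(** In [g = f + (g - f)] the second summand vanishes near [x]. *)
Lemma near_eq_differentiable f g x :
  {near x, f =1 g} -> differentiable f x -> differentiable g x.
Proof.
move=> fg df; have -> : g = f + (g - f) by rewrite addrC subrK.
apply: (differentiableD df); apply: near0_differentiable.
near=> y; rewrite !fctE; have -> : f y = g y by near: y.
  by rewrite subrr.
Unshelve. all: by end_near. Qed.

End NearDifferentiable.

(** * Twice differentiable scalar functions *)

Section TwiceDifferentiable.
Context {R : realType} {V : normedModType R}.
Implicit Types (f g : V -> R) (x v : V).

(** The second order is imposed on each directional derivative separately, so every closure property
    reduces to first-order rules for scalar functions. *)
Definition differentiable2 g x :=
  (\forall y \near x, differentiable g y) /\
  forall v, differentiable (fun y => 'D_v g y) x.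

Lemma near_differentiable2 f g x :
  {near x, f =1 g} -> differentiable2 f x -> differentiable2 g x.
Proof.
(* Agreement near [x] is also agreement around each point close to [x], so the directional
   derivatives coincide there as well. *)
move=> fg [df d2f]; have fg' := near_join fg; split.
  by near=> y; apply: (near_eq_differentiable (f := f)); near: y.
move=> v; apply: near_eq_differentiable (d2f v).
by near=> y; apply: near_eq_derive; near: y.
Unshelve. all: by end_near. Qed.

Lemma differentiable2_at g x : differentiable2 g x -> differentiable g x.
Proof. by move=> [/nbhs_singleton]. Qed.

Lemma differentiable2_continuous g x : differentiable2 g x -> {for x, continuous g}.
Proof. by move=> /differentiable2_at /differentiable_continuous. Qed.

Lemma differentiable2_cst (c : R) x : differentiable2 (cst c) x.
Proof.
split=> [|v]; first by near=> y; exact: differentiable_cst.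
by under [fun _ => _]funext do rewrite derive_cst; exact: differentiable_cst.
Unshelve. all: by end_near. Qed.

Lemma differentiable2D f g x :
  differentiable2 f x -> differentiable2 g x -> differentiable2 (f + g) x.
Proof.
move=> [df d2f] [dg d2g]; split.
  by near=> y; apply: differentiableD; near: y.
move=> v.
apply: (near_eq_differentiable (f := (fun y => 'D_v f y) + (fun y => 'D_v g y))).
  by near=> y; rewrite !fctE deriveD //; apply: diff_derivable; near: y.
exact: differentiableD.
Unshelve. all: by end_near. Qed.

Lemma differentiable2M f g x :
  differentiable2 f x -> differentiable2 g x -> differentiable2 (f * g) x.
Proof.
move=> [df d2f] [dg d2g]; split.
  by near=> y; apply: differentiableM; near: y.
move=> v.
apply: (near_eq_differentiable
  (f := f * (fun y => 'D_v g y) + g * (fun y => 'D_v f y))).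
  by near=> y; rewrite !fctE deriveM //; apply: diff_derivable; near: y.
have dfx := nbhs_singleton df; have dgx := nbhs_singleton dg.
by apply: differentiableD; exact: differentiableM.
Unshelve. all: by end_near. Qed.

Lemma differentiable2_sum (I : Type) (r : seq I) (P : pred I) (F : I -> V -> R) x :
  (forall i, differentiable2 (F i) x) ->
  differentiable2 (fun y => \sum_(i <- r | P i) F i y) x.
Proof.
move=> dF; elim: r => [|i r IH].
  by under [fun _ => _]funext do rewrite big_nil; exact: differentiable2_cst.
under [fun _ => _]funext do rewrite big_cons.
by case: (P i) => //; exact: differentiable2D.
Qed.

Lemma differentiable2_prod (I : Type) (r : seq I) (P : pred I) (F : I -> V -> R) x :
  (forall i, differentiable2 (F i) x) ->
  differentiable2 (fun y => \prod_(i <- r | P i) F i y) x.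
Proof.
move=> dF; elim: r => [|i r IH].
  by under [fun _ => _]funext do rewrite big_nil; exact: differentiable2_cst.
under [fun _ => _]funext do rewrite big_cons.
by case: (P i) => //; exact: differentiable2M.
Qed.

(** Near [x] the derivative of the composite along [v] is [dphi (g y) * 'D_v g y], a product of two
    functions differentiable at [x]. *)
Lemma differentiable2_comp (phi dphi : R -> R) g x :
  (\forall y \near g x, is_derive (y : R) 1 phi (dphi y)) ->
  derivable dphi (g x) 1 ->
  differentiable2 g x -> differentiable2 (phi \o g) x.
Proof.
move=> phiE ddphi dg; have gx := differentiable2_continuous dg.
case: dg => dg d2g.
have phigE : \forall y \near x, is_derive (g y : R) 1 phi (dphi (g y)) := gx _ phiE.
have dphig : \forall y \near x, differentiable phi (g y).
  by apply: filterS phigE => y [/derivable1_diffP].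
split; first by near=> y; apply: differentiable_comp; near: y.
move=> v.
apply: (near_eq_differentiable (f := (dphi \o g) * (fun y => 'D_v g y))).
  near=> y; have dgy : differentiable g y by near: y.
  have dphiy : differentiable phi (g y) by near: y.
  have phiy : is_derive (g y : R) 1 phi (dphi (g y)) by near: y.
  rewrite !fctE /= [RHS]deriveE; last exact: differentiable_comp.
  rewrite diff_comp //= deriv1E /=; last by case: phiy.
  by rewrite derive1E derive_val -deriveE // mulrC.
apply: differentiableM => //; apply: differentiable_comp.
  exact: nbhs_singleton dg.
exact/derivable1_diffP.
Unshelve. all: by end_near. Qed.

Lemma differentiable2V g x :
  g x != 0 -> differentiable2 g x -> differentiable2 (fun y => (g y)^-1) x.
Proof.
move=> gx0; apply: (differentiable2_comp (phi := GRing.inv)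
  (dphi := - (GRing.inv * GRing.inv))).
  near=> y; have y0 : y != 0.
    by near: y; apply: (@cvgr_neq0 _ _ _ _ _ id _ _ gx0); exact: cvg_id.
  have := is_deriveV (f := id) y0 (is_derive_id y 1).
  by rewrite /GRing.scale /= mulr1 expr2 invfM.
have dV : derivable (GRing.inv : R -> R) (g x) 1.
  by apply: (@derivableV _ _ id).
exact: derivableN (derivableM dV dV).
Unshelve. all: by end_near. Qed.

Lemma differentiable2_sqrt g x :
  0 < g x -> differentiable2 g x -> differentiable2 (fun y => Num.sqrt (g y)) x.
Proof.
move=> gx0; apply: (differentiable2_comp (phi := Num.sqrt)
  (dphi := fun y => (2 * Num.sqrt y)^-1)).
  by near=> y; apply: is_derive1_sqrt; near: y; exact: lt_nbhsr.
apply: derivableV; first by rewrite mulf_neq0 // sqrtr_eq0 -ltNge.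
have [ds _] := is_derive1_sqrt gx0.
exact: (derivableM (f := cst 2) (derivable_cst _ _ _) ds).
Unshelve. all: by end_near. Qed.

End TwiceDifferentiable.

(** * Matrices with twice differentiable entries *)

Section TwiceDifferentiableMatrix.
Context {R : realType} {V : normedModType R}.
Implicit Type x : V.

Definition mx_differentiable2 {p q} (M : V -> 'M[R]_(p, q)) x :=
  forall i j, differentiable2 (fun y => M y i j) x.

Lemma mx_differentiable2_cst p q (A : 'M[R]_(p, q)) x :
  mx_differentiable2 (fun=> A) x.
Proof. by move=> i j; exact: differentiable2_cst. Qed.

Lemma mx_differentiable2D p q (A B : V -> 'M[R]_(p, q)) x :
  mx_differentiable2 A x -> mx_differentiable2 B x ->
  mx_differentiable2 (fun y => A y + B y) x.
Proof.
move=> dA dB i j; under [fun _ => _]funext do rewrite mxE.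
exact: differentiable2D.
Qed.

Lemma mx_differentiable2Z p q (a : V -> R) (A : V -> 'M[R]_(p, q)) x :
  differentiable2 a x -> mx_differentiable2 A x ->
  mx_differentiable2 (fun y => a y *: A y) x.
Proof.
move=> da dA i j; under [fun _ => _]funext do rewrite mxE.
exact: differentiable2M.
Qed.

Lemma mx_differentiable2N p q (A : V -> 'M[R]_(p, q)) x :
  mx_differentiable2 A x -> mx_differentiable2 (fun y => - A y) x.
Proof.
move=> dA; under [fun _ => _]funext do rewrite -scaleN1r.
by apply: mx_differentiable2Z => //; exact: differentiable2_cst.
Qed.

Lemma mx_differentiable2M p q s (A : V -> 'M[R]_(p, q)) (B : V -> 'M[R]_(q, s)) x :
  mx_differentiable2 A x -> mx_differentiable2 B x ->
  mx_differentiable2 (fun y => A y *m B y) x.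
Proof.
move=> dA dB i j; under [fun _ => _]funext do rewrite mxE.
by apply: differentiable2_sum => k; exact: differentiable2M.
Qed.

Lemma mx_differentiable2_tr p q (A : V -> 'M[R]_(p, q)) x :
  mx_differentiable2 A x -> mx_differentiable2 (fun y => (A y)^T) x.
Proof. by move=> dA i j; under [fun _ => _]funext do rewrite mxE. Qed.

Lemma mx_differentiable2_row_mx p q1 q2 (A : V -> 'M[R]_(p, q1))
    (B : V -> 'M[R]_(p, q2)) x :
  mx_differentiable2 A x -> mx_differentiable2 B x ->
  mx_differentiable2 (fun y => row_mx (A y) (B y)) x.
Proof.
by move=> dA dB i j; under [fun _ => _]funext do rewrite mxE; case: fintype.split.
Qed.

Lemma mx_differentiable2_col_mx p1 p2 q (A : V -> 'M[R]_(p1, q))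
    (B : V -> 'M[R]_(p2, q)) x :
  mx_differentiable2 A x -> mx_differentiable2 B x ->
  mx_differentiable2 (fun y => col_mx (A y) (B y)) x.
Proof.
by move=> dA dB i j; under [fun _ => _]funext do rewrite mxE; case: fintype.split.
Qed.

Lemma mx_differentiable2_diag p (d : V -> 'rV[R]_p) x :
  mx_differentiable2 d x -> mx_differentiable2 (fun y => diag_mx (d y)) x.
Proof.
move=> dd i j; under [fun _ => _]funext do rewrite mxE.
case: (i == j); first exact: dd.
exact: (differentiable2_cst 0).
Qed.

Lemma mx_differentiable2_vec p q (A : V -> 'M[R]_(p, q)) x :
  mx_differentiable2 A x -> mx_differentiable2 (fun y => mxvec (A y)) x.
Proof.
move=> dA i k; rewrite ord1; case/mxvec_indexP: k => k l.
by under [fun _ => _]funext do rewrite mxvecE.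
Qed.

Lemma mx_differentiable2_vec_mx p q (A : V -> 'rV[R]_(p * q)) x :
  mx_differentiable2 A x -> mx_differentiable2 (fun y => vec_mx (A y)) x.
Proof. by move=> dA i j; under [fun _ => _]funext do rewrite mxE. Qed.

(** An entry of the matrix of a linear map is a coordinate of its value on a constant basis matrix,
    so only the factor [A y] varies. *)
Lemma mx_differentiable2_lin_mulmx p q s (A : V -> 'M[R]_(p, q)) x :
  mx_differentiable2 A x ->
  mx_differentiable2 (fun y => lin_mx (mulmx (A y) : 'M[R]_(q, s) -> _)) x.
Proof.
move=> dA i j; under [fun _ => _]funext do rewrite !mxE /=.
apply: mx_differentiable2_vec; apply: mx_differentiable2M => //.
exact: mx_differentiable2_cst.
Qed.

Lemma mx_differentiable2_lin_mulmxr p q s (A : V -> 'M[R]_(p, q)) x :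
  mx_differentiable2 A x ->
  mx_differentiable2 (fun y => lin_mx (mulmxr (A y) : 'M[R]_(s, p) -> _)) x.
Proof.
move=> dA i j; under [fun _ => _]funext do rewrite !mxE /=.
apply: mx_differentiable2_vec; apply: mx_differentiable2M => //.
exact: mx_differentiable2_cst.
Qed.

Lemma differentiable2_det p (A : V -> 'M[R]_p) x :
  mx_differentiable2 A x -> differentiable2 (fun y => \det (A y)) x.
Proof.
move=> dA; apply: differentiable2_sum => s.
apply: differentiable2M; first exact: differentiable2_cst.
exact: differentiable2_prod.
Qed.

Lemma mx_differentiable2_adj p (A : V -> 'M[R]_p) x :
  mx_differentiable2 A x -> mx_differentiable2 (fun y => \adj (A y)) x.
Proof.
move=> dA i j; under [fun _ => _]funext do rewrite mxE.
apply: differentiable2M; first exact: differentiable2_cst.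
by apply: differentiable2_det => k l; under [fun _ => _]funext do rewrite !mxE.
Qed.

Lemma near_unitmx p (A : V -> 'M[R]_p) x :
  mx_differentiable2 A x -> A x \in unitmx -> \forall y \near x, A y \in unitmx.
Proof.
move=> dA; rewrite unitmxE unitfE => Ax.
have /differentiable2_continuous cA := differentiable2_det dA.
near=> y; rewrite unitmxE unitfE; near: y.
exact: cvgr_neq0 cA Ax.
Unshelve. all: by end_near. Qed.

Lemma mx_differentiable2_inv p (A : V -> 'M[R]_p) x :
  mx_differentiable2 A x -> A x \in unitmx ->
  mx_differentiable2 (fun y => invmx (A y)) x.
Proof.
move=> dA Ax i j.
apply: (near_differentiable2 (f := fun y => ((\det (A y))^-1 *: \adj (A y)) i j)).
  (* Off the invertible matrices [invmx] returns its argument; the adjugate formula holds because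
     [A y] stays invertible near [x]. *)
  near=> y; rewrite /invmx ifT //; near: y; exact: near_unitmx.
apply: mx_differentiable2Z; last exact: mx_differentiable2_adj.
by apply: differentiable2V; [rewrite -unitfE -unitmxE|exact: differentiable2_det].
Unshelve. all: by end_near. Qed.

End TwiceDifferentiableMatrix.

(** * Second-order Taylor expansion with Peano remainder *)

Section Peano.
Context {R : realType}.

Lemma MVT_derivable (f df : R -> R) (a b : R) : a < b ->
  (forall s, s \in `[a, b]%R -> is_derive s 1 f (df s)) ->
  exists2 c, c \in `]a, b[%R & f b - f a = df c * (b - a).
Proof.
move=> ab fE.
have fE' s : s \in `]a, b[%R -> is_derive s 1 f (df s).
  by move=> /subset_itv_oo_cc; exact: fE.
have fc : {within `[a, b], continuous f}.
  apply: derivable_within_continuous => s /fE fs.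
  exact: (@ex_derive _ _ _ _ _ _ _ fs).
by have := MVT ab fE' fc.
Qed.

(** The remainder [phi] has derivative [dh s - dh 0 - s * d2], which is o(s) by differentiability of
    [dh] at 0. The mean value theorem on [0, t] then bounds [phi t] by e t^2. *)
Lemma taylor2_right (h dh : R -> R) (d2 : R) :
  (\forall t \near (0 : R), is_derive (t : R) 1 h (dh t)) ->
  is_derive (0 : R) 1 dh d2 ->
  (h t - h 0 - t * dh 0) / t ^+ 2 @[t --> 0^'+] --> d2 / 2.
Proof.
move=> hE [ddh d2E].
have dhcvg : s^-1 *: (dh (s *: (1 : R) + 0) - dh 0) @[s --> 0^'] --> d2.
  by rewrite -d2E; exact: ddh.
apply/cvgrPdist_le => e e0.
have /nbhs_ballP[d /= d0 hd] := hE.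
move/cvgrPdist_le: dhcvg => /(_ e e0)[d' /= d'0 hd'].
near=> t.
have t0 : 0 < t by near: t; exact: nbhs_right_gt.
have td : t < d by near: t; exact: nbhs_right_lt.
have td' : t < d' by near: t; exact: nbhs_right_lt.
pose phi s := h s - h 0 - s * dh 0 - s ^+ 2 * (d2 / 2).
have phiE s : s \in `[0, t]%R -> is_derive (s : R) 1 phi (dh s - dh 0 - s * d2).
  rewrite in_itv /= => /andP[s0 st].
  have hs : is_derive (s : R) 1 h (dh s).
    by apply: hd; rewrite /ball /= sub0r normrN ger0_norm // (le_lt_trans st).
  have sD : is_derive (s : R) 1 (dh 0 *: (id : R -> R)) (dh 0 *: (1 : R)).
    exact: is_deriveZ.
  have s2D : is_derive (s : R) 1 ((d2 / 2) *: (id ^+ 2 : R -> R))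
      ((d2 / 2) *: ((2%:R * s ^+ 1) *: (1 : R))).
    exact: is_deriveZ.
  have phiD := is_deriveB (is_deriveB (is_deriveB hs (is_derive_cst (h 0) s 1)) sD) s2D.
  have -> : phi = h - cst (h 0) - dh 0 *: id - (d2 / 2) *: id ^+ 2.
    by apply/funext => u; rewrite /phi !fctE /GRing.scale /= mulrC [_ ^+ 2 * _]mulrC.
  by apply: (is_derive_eq phiD); rewrite /GRing.scale /=; field.
have [c] := MVT_derivable t0 phiE.
rewrite in_itv /= => /andP[c0 ct] phiMVT.
have phi0 : phi 0 = 0 by rewrite /phi subrr !mul0r expr0n /= mul0r !subr0.
have dhc : `|dh c - dh 0 - c * d2| <= e * c.
  have := hd' c; rewrite /= sub0r normrN gtr0_norm // => /(_ (lt_trans ct td')).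
  move=> /(_ (lt0r_neq0 c0)); rewrite /GRing.scale /= mulr1 addr0 => hc.
  have -> : dh c - dh 0 - c * d2 = - (c * (d2 - c^-1 * (dh c - dh 0))).
    by field; exact: lt0r_neq0.
  by rewrite normrN normrM gtr0_norm // mulrC ler_pM2r.
have tn0 := lt0r_neq0 t0.
have -> : d2 / 2 - (h t - h 0 - t * dh 0) / t ^+ 2 = - (phi t / t ^+ 2).
  by rewrite /phi; field.
rewrite normrN -[phi t]subr0 -phi0 phiMVT subr0 normrM normfV normrX normrM.
rewrite (gtr0_norm t0) ler_pdivrMr ?exprn_gt0 // expr2 mulrA ler_pM2r //.
by apply: (le_trans dhc); rewrite ler_pM2l // ltW.
Unshelve. all: by end_near. Qed.

End Peano.

(** * One-sided second-order expansions along a direction *)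

Section Expansion.
Context {R : realType}.

(** This is g(x + t v) = g(x) + t c1 + t^2 c2 + o(t^2) for t decreasing to 0. The coefficient [c1]
    is a parameter instead of [dderiv1], so expansions can be combined first and both derivatives
    read off afterwards; [c2] is half the second one. *)
Definition expands2 {V : lmodType R} (g : V -> R) (x v : V) (c1 c2 : R) : Prop :=
  (g (x + t *: v) - g x - t * c1) / t ^+ 2 @[t --> 0^'+] --> c2.

(** The difference quotient equals c1 + t q(t) with q(t) tending to [c2]. *)
Lemma expands2_dquot1 (V : lmodType R) (g : V -> R) x v c1 c2 :
  expands2 g x v c1 c2 -> dquot1 g x v t @[t --> 0^'+] --> c1.
Proof.
move=> gE; have id0 : (t : R) @[t --> (0 : R)^'+] --> (0 : R).
  by apply: cvg_within_filter; exact: cvg_id.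
have : c1 + t * ((g (x + t *: v) - g x - t * c1) / t ^+ 2) @[t --> 0^'+] --> c1.
  rewrite -[X in _ --> X]addr0 -[X in c1 + X](mul0r c2).
  by apply: cvgD; [exact: cvg_cst|exact: cvgM].
apply: cvg_trans; apply: near_eq_cvg; near=> t.
have t0 : t != 0 by apply: lt0r_neq0; near: t; exact: nbhs_right_gt.
by rewrite /dquot1; field.
Unshelve. all: by end_near. Qed.

Lemma expands2_dderiv1 (V : lmodType R) (g : V -> R) x v c1 c2 :
  expands2 g x v c1 c2 -> has_dderiv1 g x v /\ dderiv1 g x v = c1.
Proof.
move=> /expands2_dquot1 gE; split; first by apply/cvg_ex; exists c1.
exact: cvg_lim gE.
Qed.

Lemma expands2_dderiv2 (V : lmodType R) (g : V -> R) x v c1 c2 :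
  expands2 g x v c1 c2 -> has_dderiv2 g x v /\ dderiv2 g x v = 2 * c2.
Proof.
move=> gE; have [g1 g1E] := expands2_dderiv1 gE.
have gE' : dquot2 g x v t @[t --> 0^'+] --> c2 by rewrite /dquot2 g1E.
split; first by split => //; apply/cvg_ex; exists c2.
by congr (2 * _); exact: cvg_lim gE'.
Qed.

Lemma expands2D (V : lmodType R) (f g : V -> R) x v c1 c2 d1 d2 :
  expands2 f x v c1 c2 -> expands2 g x v d1 d2 ->
  expands2 (fun y => f y + g y) x v (c1 + d1) (c2 + d2).
Proof.
move=> fE gE; apply: cvg_trans (cvgD fE gE); apply: near_eq_cvg.
near=> t; rewrite !fctE -mulrDl; congr (_ * _).
by rewrite mulrDr !opprD addrACA; congr (_ + _); rewrite addrACA.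
Unshelve. all: by end_near. Qed.

Lemma expands2Z (V : lmodType R) (g : V -> R) x v c1 c2 (a : R) :
  expands2 g x v c1 c2 -> expands2 (fun y => a * g y) x v (a * c1) (a * c2).
Proof.
move=> gE; apply: cvg_trans (cvgM (cvg_cst a) gE); apply: near_eq_cvg.
near=> t; rewrite -[LHS]/(a * ((g (x + t *: v) - g x - t * c1) / t ^+ 2)).
by rewrite mulrA !mulrBr mulrCA.
Unshelve. all: by end_near. Qed.

(** The two-sided function [h] has to match [g] along the ray for t > 0 only, so a [g] with a kink
    at [x], such as the arcsine of an absolute value, is covered. *)
Lemma expands2_line (V : lmodType R) (g : V -> R) x v (h dh : R -> R) d2 :
  (\forall t \near 0^'+, g (x + t *: v) = h t) -> g x = h 0 ->
  (\forall t \near (0 : R), is_derive (t : R) 1 h (dh t)) ->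
  is_derive (0 : R) 1 dh d2 ->
  expands2 g x v (dh 0) (d2 / 2).
Proof.
move=> gh gh0 hE dhE; apply: cvg_trans (taylor2_right hE dhE).
apply: near_eq_cvg; near=> t; rewrite gh0.
by have -> : g (x + t *: v) = h t by near: t.
Unshelve. all: by end_near. Qed.

Lemma line_cvg0 (V : normedModType R) (x v : V) :
  x + t *: v @[t --> (0 : R)] --> x.
Proof.
rewrite -[X in _ --> X]addr0 -[X in x + X](scale0r v).
by apply: cvgD; [exact: cvg_cst|apply: cvgZr_tmp; exact: cvg_id].
Qed.

Lemma is_derive_line (V : normedModType R) (g : V -> R) x v (t : R) :
  differentiable g (x + t *: v) ->
  is_derive t 1 (fun s : R => g (x + s *: v)) ('D_v g (x + t *: v)).
Proof.
move=> dg.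
have shiftE : (fun h : R => h^-1 *: (g (x + (h *: (1 : R) + t) *: v) - g (x + t *: v))) =
    (fun h : R => h^-1 *: (g (h *: v + (x + t *: v)) - g (x + t *: v))).
  apply/funext => h; have -> : h *: (1 : R) = h by exact: mulr1.
  by rewrite scalerDl addrCA.
have := diff_derivable (v := v) dg.
by split; rewrite /derivable /derive shiftE.
Qed.

Lemma differentiable2_expands2 (V : normedModType R) (g : V -> R) x v :
  differentiable2 g x ->
  expands2 g x v ('D_v g x) ('D_v (fun y => 'D_v g y) x / 2).
Proof.
move=> [dg d2g]; have xE : x = x + 0 *: v by rewrite scale0r addr0.
have gl := @line_cvg0 V x v _ dg.
rewrite [in 'D_v g x]xE.
apply: (expands2_line (h := fun t => g (x + t *: v))
  (dh := fun t => 'D_v g (x + t *: v))).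
- by near=> t.
- by rewrite -xE.
- by near=> t; apply: is_derive_line; near: t; exact: gl.
- by rewrite {2}xE; apply: is_derive_line; rewrite -xE.
Unshelve. all: by end_near. Qed.

End Expansion.

(** * Second derivatives and the Hessian *)

Section HessianOfDifferentiable.
Context {R : realType} {n : nat}.
Implicit Types (g : 'cV[R]_n -> R) (x v : 'cV[R]_n).

Lemma derive_sum_unit_vec g x v : differentiable g x ->
  'D_v g x = \sum_j v j 0 * 'D_(unit_vec j) g x.
Proof.
move=> dg; rewrite deriveE // [in LHS](matrix_sum_delta v) linear_sum /=.
apply: eq_bigr => i _; rewrite big_ord1 linearZ /=.
by rewrite -deriveE.
Qed.

Lemma differentiable2_has_hessian g x : differentiable2 g x -> has_hessian g x.
Proof.
move=> [dg d2g]; split; first by apply: filterS dg => y dg j; exact: diff_derivable.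
by move=> i j; apply: diff_derivable; exact: d2g.
Qed.

(** Both derivatives along [v] are expanded in the unit vectors; the inner expansion must hold in a
    neighbourhood of [x], since it is differentiated again. *)
Lemma derive2_hessian g x v : differentiable2 g x ->
  'D_v (fun y => 'D_v g y) x = (v^T *m hessian g x *m v) 0 0.
Proof.
move=> [dg d2g].
have dgE : \forall y \near x,
    'D_v g y = (\sum_j (v j 0 \*: (fun y => 'D_(unit_vec j) g y))) y.
  by apply: filterS dg => y dgy; rewrite derive_sum_unit_vec // fct_sumE.
rewrite derive_sum_unit_vec // mxE.
under [RHS]eq_bigr do rewrite mxE mulr_suml.
rewrite exchange_big; apply: eq_bigr => i _ /=.
rewrite (near_eq_derive _ dgE) derive_sum => [|j]; last first.
  by apply: derivableZ; exact: diff_derivable.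
rewrite mulr_sumr; apply: eq_bigr => j _.
rewrite deriveZ; last exact: diff_derivable.
by rewrite !mxE -mulrA; congr (_ * _); rewrite mulrC.
Qed.

Lemma differentiable2_coord (i : 'I_n) x :
  differentiable2 (fun y : 'cV[R]_n => y i 0) x.
Proof.
split=> [|v]; first by near=> y; exact: differentiable_coord.
rewrite (_ : (fun y => _) = cst (v i 0)); first exact: differentiable_cst.
apply/funext => y.
have idD : derivable (id : 'cV[R]_n -> 'cV[R]_n) y v by exact: derivable_id.
have := derive_mx idD.
by rewrite derive_id => /matrixP/(_ i 0); rewrite mxE.
Unshelve. all: by end_near. Qed.

End HessianOfDifferentiable.

(** * Maximum of a finite family *)

Section FiniteMaximum.
Context {R : realType} {n : nat}.
Implicit Types (I : {set 'I_n}) (F : 'I_n -> R).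

Lemma finmax_ge I F k : k \in I -> F k <= finmax I F.
Proof.
rewrite /finmax => kI; case: pickP => [k0 _|/(_ k)]; last by rewrite kI.
exact: le_bigmax_cond.
Qed.

Lemma finmax_attained I F k : k \in I -> exists2 k', k' \in I & finmax I F = F k'.
Proof.
rewrite /finmax => kI; case: pickP => [k0 k0I|/(_ k)]; last by rewrite kI.
apply: (big_ind (fun a => exists2 k', k' \in I & a = F k')).
- by exists k0.
- move=> a b [k1 k1I ->] [k2 k2I ->].
  by rewrite maxEle; case: ifP => _; [exists k2|exists k1].
- by move=> k' k'I; exists k'.
Qed.

Lemma eq_finmax I F F' : (forall k, k \in I -> F k = F' k) ->
  finmax I F = finmax I F'.
Proof.
move=> FF'; rewrite /finmax; case: pickP => // k0 k0I.
by rewrite FF' //; apply: eq_bigr => k; exact: FF'.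
Qed.

Lemma finmaxM I F (a : R) : 0 <= a -> finmax I (fun k => a * F k) = a * finmax I F.
Proof.
move=> a0; rewrite /finmax; case: pickP => [k0 k0I|_]; last by rewrite mulr0.
apply: (big_ind2 (fun b c => b = a * c)) => // b1 b2 c1 c2 -> ->.
by rewrite maxr_pMr.
Qed.

End FiniteMaximum.

(** * Expansion of a finite maximum *)

Section ExpansionOfMaximum.
Context {R : realType} {V : lmodType R} {n : nat}.
Implicit Types (x v : V).

(** The triple ([g x], [a1], [a2]) is lexicographically at most ([c0], [c1], [c2]). A strict gap at
    order 0 or 1 dominates all higher terms for small t; without such a gap the margin [e]
    decides. *)
Lemma expands2_near_le (g : V -> R) x v a1 a2 (c0 c1 c2 e : R) :
  expands2 g x v a1 a2 -> 0 < e -> g x <= c0 ->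
  (g x = c0 -> a1 <= c1) -> (g x = c0 -> a1 = c1 -> a2 <= c2) ->
  \forall t \near 0^'+, (g (x + t *: v) - c0 - t * c1) / t ^+ 2 < c2 + e.
Proof.
move=> gE e0; set q := fun t : R => (g (x + t *: v) - g x - t * a1) / t ^+ 2.
have qE : q t @[t --> 0^'+] --> a2 by [].
have id0 : (t : R) @[t --> (0 : R)^'+] --> (0 : R).
  by apply: cvg_within_filter; exact: cvg_id.
have gq t : 0 < t -> g (x + t *: v) = g x + t * (a1 + t * q t).
  by move=> t0; have tn0 := lt0r_neq0 t0; rewrite /q; field.
rewrite le_eqVlt => /orP[/eqP gx|gx _ _]; last first.
  (* The quotient itself diverges here. After multiplication by t^2 the claim compares with [c0] an
     expression tending to [g x < c0]. *)
  have cv : g x + t * (a1 + t * (q t - (c2 + e)) - c1) @[t --> 0^'+] -->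
      g x + 0 * (a1 + 0 * (a2 - (c2 + e)) - c1).
    apply: cvgD; first exact: cvg_cst.
    apply: cvgM => //; apply: cvgB; last exact: cvg_cst.
    apply: cvgD; first exact: cvg_cst.
    by apply: cvgM => //; apply: cvgB => //; exact: cvg_cst.
  rewrite mul0r addr0 in cv.
  near=> t; have t0 : 0 < t by near: t; exact: nbhs_right_gt.
  have : g x + t * (a1 + t * (q t - (c2 + e)) - c1) < c0.
    by near: t; exact: (cvgr_lt _ cv).
  rewrite ltr_pdivrMr ?exprn_gt0 // gq //; nra.
rewrite gx => /(_ erefl) + /(_ erefl); rewrite le_eqVlt => /orP[/eqP a1c1|a1c1 _].
  move=> /(_ a1c1) a2c2.
  near=> t; have t0 : 0 < t by near: t; exact: nbhs_right_gt.
  have : q t < c2 + e.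
    by near: t; apply: (cvgr_lt _ qE); rewrite (le_lt_trans a2c2) // ltrDl.
  have tn0 := lt0r_neq0 t0; congr (_ < _).
  by rewrite gq // gx a1c1; field.
have cv : a1 + t * (q t - (c2 + e)) @[t --> 0^'+] --> a1 + 0 * (a2 - (c2 + e)).
  apply: cvgD; first exact: cvg_cst.
  by apply: cvgM => //; apply: cvgB => //; exact: cvg_cst.
rewrite mul0r addr0 in cv.
near=> t; have t0 : 0 < t by near: t; exact: nbhs_right_gt.
have : a1 + t * (q t - (c2 + e)) < c1 by near: t; exact: (cvgr_lt _ cv).
rewrite ltr_pdivrMr ?exprn_gt0 // gq // gx; nra.
Unshelve. all: by end_near. Qed.

(** A squeeze: the maximum is at least [F k0], and at each point it equals some [F k]. As there are
    finitely many indices, one range of t makes all their quotients smaller than [a2 k0 + e]. *)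
Lemma expands2_max (F : 'I_n -> V -> R) x v (a1 a2 : 'I_n -> R) k0 :
  (forall k, expands2 (F k) x v (a1 k) (a2 k)) ->
  (forall k, F k x <= F k0 x) ->
  (forall k, F k x = F k0 x -> a1 k <= a1 k0) ->
  (forall k, F k x = F k0 x -> a1 k = a1 k0 -> a2 k <= a2 k0) ->
  expands2 (fun y => finmax [set: 'I_n] (fun k => F k y)) x v (a1 k0) (a2 k0).
Proof.
move=> FE F0 F1 F2; rewrite /expands2.
have fx : finmax [set: 'I_n] (F^~ x) = F k0 x.
  apply/eqP; rewrite eq_le finmax_ge // andbT.
  by have [k _ ->] := finmax_attained (F^~ x) (finset.in_setT k0).
rewrite fx; apply/cvgrPdist_lt => e e0.
have Fle : \forall t \near 0^'+, forall k,
    (F k (x + t *: v) - F k0 x - t * a1 k0) / t ^+ 2 < a2 k0 + e.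
  apply: filter_forall => k; apply: (expands2_near_le (FE k)) => //.
    exact: F1.
  exact: F2.
have Fge : \forall t \near 0^'+,
    a2 k0 - e < (F k0 (x + t *: v) - F k0 x - t * a1 k0) / t ^+ 2.
  set q := fun t : R => (F k0 (x + t *: v) - F k0 x - t * a1 k0) / t ^+ 2.
  have qE : q t @[t --> 0^'+] --> a2 k0 := FE k0.
  by apply: (cvgr_gt _ qE); rewrite ltrBlDr ltrDl.
near=> t; have t0 : 0 < t by near: t; exact: nbhs_right_gt.
have lb : F k0 (x + t *: v) <= finmax [set: 'I_n] (F^~ (x + t *: v)).
  exact: finmax_ge.
have [k _ fk] := finmax_attained (F^~ (x + t *: v)) (finset.in_setT k0).
rewrite distrC ltr_distl; apply/andP; split.
  have : a2 k0 - e < (F k0 (x + t *: v) - F k0 x - t * a1 k0) / t ^+ 2 by near: t.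
  move=> /lt_le_trans -> //; rewrite ler_pM2r ?invr_gt0 ?exprn_gt0 //.
  by rewrite !lerB.
have Flt : forall k, (F k (x + t *: v) - F k0 x - t * a1 k0) / t ^+ 2 < a2 k0 + e.
  by near: t.
by rewrite fk.
Unshelve. all: by end_near. Qed.

(** Maximizing first [a1] over the active indices and then [a2] over the maximizers yields a
    lexicographically largest index [k2]. Nonemptiness of [J] ensures that [finmax J a2] is a
    genuine maximum and not the dummy value. *)
Lemma expands2_finmax (F : 'I_n -> V -> R) x v (a1 a2 : 'I_n -> R) k0 :
  let f y := finmax [set: 'I_n] (fun k => F k y) in
  let I := [set k | F k x == f x]%SET in
  let J := [set k in I | a1 k == finmax I a1]%SET in
  k0 \in I ->
  (forall k, expands2 (F k) x v (a1 k) (a2 k)) ->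
  (exists k, k \in J) /\ expands2 f x v (finmax I a1) (finmax J a2).
Proof.
move=> f I J k0I FE.
have [k1 k1I k1E] := finmax_attained a1 k0I.
have k1J : k1 \in J by rewrite inE k1I k1E /=.
split; first by exists k1.
have [k2 k2J k2E] := finmax_attained a2 k1J.
have := k2J; rewrite inE => /andP[k2I /eqP a1k2].
have fE : f x = F k2 x by move: k2I; rewrite inE => /eqP.
rewrite k2E -a1k2; apply: expands2_max => // k.
- by rewrite -fE; apply: (finmax_ge (F^~ x)).
- by rewrite -fE a1k2 => Fk; apply: finmax_ge; rewrite inE Fk.
- rewrite -fE => Fk a1k; rewrite -k2E; apply: finmax_ge.
  by rewrite !inE Fk eqxx a1k a1k2 /=.
Qed.

End ExpansionOfMaximum.

(** * The homogeneous Sylvester equation *)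

Section Sylvester.
Context {F : closedFieldType} {n : nat}.
Implicit Types A N X : 'M[F]_n.+1.

Lemma horner_mx_intertwine A N X (p : {poly F}) :
  A *m X = X *m N -> horner_mx A p *m X = X *m horner_mx N p.
Proof.
move=> AX; elim/poly_ind: p => [|p c IH]; first by rewrite !rmorph0 mul0mx mulmx0.
rewrite !rmorphD !rmorphM /= !horner_mx_X !horner_mx_C mulmxDl mulmxDr.
by rewrite -!mulmxE -mulmxA AX mulmxA IH -mulmxA scalar_mxC.
Qed.

Lemma eigenvalue_unitmx A z : ~~ eigenvalue A z = (A - z%:M \in unitmx).
Proof. by rewrite /eigenvalue negbK kermx_eq0 row_free_unit. Qed.

Lemma eigenvalue_opp_tr A z : eigenvalue (- A^T) z = eigenvalue A (- z).
Proof.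
apply: negb_inj; rewrite !eigenvalue_unitmx raddfN opprK -unitmx_tr.
have -> : A + z%:M = - (-1) *: (A + z%:M) by rewrite opprK scale1r.
rewrite scaleNr scaleN1r opprK linearB linearN /= trmxK tr_scalar_mx -opprD.
by rewrite -scaleN1r unitmxZ ?unitrN1.
Qed.

(** Let p be the characteristic polynomial of [A]. By Cayley-Hamilton X p(N) = p(A) X = 0, and p(N)
    is a product of factors N - z over eigenvalues z of [A], each invertible because z is no
    eigenvalue of [N]. *)
Lemma sylvester_eq0 A N X :
  (forall z, eigenvalue A z -> ~~ eigenvalue N z) -> A *m X = X *m N -> X = 0.
Proof.
move=> disj AX.
have := horner_mx_intertwine (char_poly A) AX.
rewrite Cayley_Hamilton mul0mx => XN.
suff Nu: horner_mx N (char_poly A) \in unitmx by rewrite -[X](mulmxK Nu) -XN mul0mx.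
have [s sE] := closed_field_poly_normal (char_poly A).
rewrite (monicP (char_poly_monic A)) scale1r in sE.
have {}disj z : z \in s -> N - z%:M \in unitmx.
  rewrite -eigenvalue_unitmx => zs; apply: disj.
  by rewrite eigenvalue_root_char sE root_prod_XsubC.
rewrite sE rmorph_prod /= big_seq.
apply: (big_ind (fun B : 'M[F]_n.+1 => B \in unitmx)).
- exact: unitmx1.
- by move=> B C Bu Cu; rewrite unitmx_mul Bu.
- by move=> z zs; rewrite rmorphB /= horner_mx_X horner_mx_C disj.
Qed.

End Sylvester.

(** * The Lyapunov equation of a Hurwitz matrix *)

Section Lyapunov.
Context {R : realType}.

(** Over the complex numbers this is a Sylvester equation for J and -J^T, whose spectra lie in
    opposite open half-planes. *)
Lemma hurwitz_lyapunov_eq0 n (J X : 'M[R]_n.+1) :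
  hurwitz J -> J *m X + X *m J^T = 0 -> X = 0.
Proof.
move=> hJ /eqP; rewrite addr_eq0 -mulmxN => /eqP JX.
pose cx := real_complex R.
apply: (map_mx_inj (f := cx)); rewrite map_mx0.
have JXc : map_mx cx J *m map_mx cx X = map_mx cx X *m map_mx cx (- J^T).
  by rewrite -!map_mxM JX.
apply: sylvester_eq0 JXc => z /hJ z0.
apply/negP => evN.
have : eigenvalue (map_mx cx J) (- z).
  by rewrite -eigenvalue_opp_tr map_trmx -map_mxN.
by move=> /hJ; rewrite raddfN /= oppr_lt0 ltNge ltW.
Qed.

Definition lyapunov_mx n (J : 'M[R]_n) : 'M[R]_(n * n) :=
  lin_mx (mulmx J : 'M[R]_n -> _) + lin_mx (mulmxr J^T : 'M[R]_n -> _).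

Lemma mul_vec_lyapunov n (J Q : 'M[R]_n) :
  mxvec Q *m lyapunov_mx J = mxvec (J *m Q + Q *m J^T).
Proof. by rewrite mulmxDr !mul_vec_lin /= linearD. Qed.

(** In contrast to a solution picked by choice, this one has entries that are visibly rational in
    those of [J], which makes it differentiable. *)
Definition lyapunov_sol n q (J : 'M[R]_n) (K : 'M[R]_(n, q)) : 'M[R]_n :=
  vec_mx (- mxvec (K *m K^T) *m invmx (lyapunov_mx J)).

Lemma hurwitz_lyapunov_unitmx n (J : 'M[R]_n.+1) :
  hurwitz J -> lyapunov_mx J \in unitmx.
Proof.
move=> hJ; rewrite -row_free_unit -kermx_eq0; apply/rowV0P => u /sub_kermxP.
rewrite -[u]vec_mxK mul_vec_lyapunov => /eqP.
rewrite mxvec_eq0 => /eqP /(hurwitz_lyapunov_eq0 hJ) ->.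
by rewrite linear0.
Qed.

Lemma lyapunov_solP n q (J Q : 'M[R]_n) (K : 'M[R]_(n, q)) :
  lyapunov_mx J \in unitmx ->
  J *m Q + Q *m J^T + K *m K^T = 0 <-> Q = lyapunov_sol J K.
Proof.
move=> Ju; split=> [/eqP|->].
  rewrite addr_eq0 => /eqP JQ; rewrite /lyapunov_sol.
  have -> : - mxvec (K *m K^T) = mxvec Q *m lyapunov_mx J.
    by rewrite mul_vec_lyapunov JQ linearN.
  by rewrite mulmxK // mxvecK.
apply: (can_inj mxvecK); rewrite linearD /= -mul_vec_lyapunov vec_mxK.
by rewrite mulmxKV // addNr linear0.
Qed.

(** Multiply the equation for [J2] by T on the left and T^T on the right; the intertwining relation
    and its transpose carry T across [J1] and its transpose. *)
Lemma lyapunov_orthogonal_conj n q (J1 J2 T Q : 'M[R]_n)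
    (K1 K2 : 'M[R]_(n, q)) :
  T *m T^T = 1%:M -> J1 *m T = T *m J2 -> K1 = T *m K2 ->
  J2 *m Q + Q *m J2^T + K2 *m K2^T = 0 ->
  J1 *m (T *m Q *m T^T) + T *m Q *m T^T *m J1^T + K1 *m K1^T = 0.
Proof.
move=> TT JT ->; have JT' : T^T *m J1^T = J2^T *m T^T by rewrite -!trmx_mul JT.
move=> /(congr1 (fun X => T *m X *m T^T)); rewrite mulmx0 mul0mx => <-.
rewrite !mulmxDr !mulmxDl trmx_mul; congr (_ + _ + _).
- by rewrite !mulmxA JT.
- by rewrite -!mulmxA JT'.
- by rewrite !mulmxA.
Qed.

End Lyapunov.

(** * Change of the diagonalizing basis *)

Section OrthogonalBasis.
Context {R : realType} {n : nat}.
Implicit Types (U V W S D : 'M[R]_n.+1).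

Let e0 : 'cV[R]_n.+1 := delta_mx 0 0.
(** Deleting the first column becomes right multiplication by [E], so the truncated blocks can be
    handled by matrix algebra. *)
Let E : 'M[R]_(n.+1, n) := col' 0 1%:M.

Lemma col'_mul q (X : 'M[R]_(q, n.+1)) : col' 0 X = X *m E.
Proof.
apply/matrixP => i j; rewrite !mxE (bigD1 (lift 0 j)) //= !mxE eqxx mulr1.
by rewrite big1 ?addr0 // => k kj; rewrite !mxE (negPf kj) mulr0.
Qed.

Lemma row_mx01_col' : row_mx (0 : 'M[R]_(n, 1)) 1%:M = E^T :> 'M[R]_(n, n.+1).
Proof.
apply/matrixP => i j; rewrite !mxE.
case: (fintype.splitP (j : 'I_(1 + n))) => k jk; rewrite !mxE.
  by rewrite -val_eqE /= jk; case: k {jk} => [[|]].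
by rewrite -!val_eqE /= jk /bump /= add1n eqSS eq_sym.
Qed.

Lemma col'_tr_mul : E^T *m E = 1%:M.
Proof.
by rewrite -col'_mul; apply/matrixP => i j; rewrite !mxE (inj_eq lift_inj) eq_sym.
Qed.

(** This is the orthogonal projection away from the first basis vector; block diagonality of W is
    expressed as commutation with it. *)
Lemma col'_mul_tr : E *m E^T = 1%:M - e0 *m e0^T.
Proof.
apply/matrixP => i j; rewrite !mxE big_ord1 !mxE eqxx !andbT.
case: (unliftP 0 i) => [k ->|->].
  rewrite (bigD1 k) //= !mxE eqxx mul1r big1 => [|l lk]; last first.
    by rewrite !mxE (inj_eq lift_inj) eq_sym (negPf lk) mul0r.
  by rewrite addr0 mul0r subr0 eq_sym.
rewrite big1 => [|l _]; last by rewrite !mxE mul0r.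
by rewrite mul1r eq_sym subrr.
Qed.

(* W fixes the line of the first basis vector and so does its transpose, hence
   W is block diagonal. *)
Lemma col'_mul_tr_comm W c d : W *m e0 = c *: e0 -> W^T *m e0 = d *: e0 ->
  W *m (E *m E^T) = E *m E^T *m W.
Proof.
move=> Wc Wd; have Wd' : e0^T *m W = d *: e0^T.
  by rewrite -[W]trmxK -trmx_mul Wd linearZ.
have cd : c = d.
  have e01 : e0^T *m e0 = 1%:M.
    apply/matrixP => i j; rewrite !ord1 mxE (bigD1 0) //= big1 => [|k k0].
      by rewrite !mxE !eqxx mul1r addr0.
    by rewrite !mxE (negPf k0) mul0r.
  have : e0^T *m W *m e0 = c%:M by rewrite -mulmxA Wc -scalemxAr e01 scalemx1.
  rewrite Wd' -scalemxAl e01 scalemx1 => /matrixP/(_ 0 0).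
  by rewrite !mxE eqxx.
rewrite col'_mul_tr mulmxBl mulmxBr mul1mx mulmx1 mulmxA Wc -mulmxA Wd' cd.
by rewrite -scalemxAl -scalemxAr.
Qed.

(** These three definitions are [Jd], [Kd] and [Cd] with the network matrices abstracted, so that
    only the dependence on the basis U remains. *)
Definition lyapunov_J S D U : 'M[R]_(n + n.+1) :=
  block_mx 0 (row_mx (0 : 'M[R]_(n, 1)) 1%:M : 'M[R]_(n, n.+1))
    (- col' 0 (U^T *m S *m U)) (- (U^T *m D *m U)).

Definition lyapunov_K q (X : 'M[R]_(n.+1, q)) U : 'M[R]_(n + n.+1, q) :=
  col_mx 0 (U^T *m X).

Definition lyapunov_C q (Y : 'M[R]_(q, n.+1)) U : 'M[R]_(q, n + n.+1) :=
  row_mx (col' 0 (Y *m U)) 0.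

(** The first block of the state has lost its first coordinate and is transformed by the compression
    of W; the second block is transformed by W itself. *)
Definition basis_change W : 'M[R]_(n + n.+1) := block_mx (E^T *m W *m E) 0 0 W.

Section Change.
Context (U V W : 'M[R]_n.+1).
Hypotheses (UU : U^T *m U = 1%:M) (VV : V^T *m V = 1%:M) (VW : V *m W = U).
Hypothesis WE : W *m (E *m E^T) = E *m E^T *m W.

Let WU : W *m U^T = V^T.
Proof. by rewrite -[W]mul1mx -VV -(mulmxA _ V) VW -mulmxA (mulmx1C UU) mulmx1. Qed.

Let EW : E *m (E^T *m W *m E) = W *m E.
Proof. by rewrite !mulmxA -WE -!mulmxA col'_tr_mul mulmx1. Qed.

Let WE' : E^T *m W *m E *m E^T = E^T *m W.
Proof.
by rewrite -!mulmxA WE !mulmxA col'_tr_mul mul1mx.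
Qed.

Lemma basis_change_orthogonal : basis_change W *m (basis_change W)^T = 1%:M.
Proof.
have WW : W *m W^T = 1%:M.
  have WVU : W = V^T *m U by rewrite -VW mulmxA VV mul1mx.
  apply: mulmx1C; rewrite WVU trmx_mul trmxK mulmxA -(mulmxA U^T).
  by rewrite (mulmx1C VV) mulmx1.
rewrite tr_block_mx !trmx0 mulmx_block !mul0mx !mulmx0 !addr0 !add0r WW.
rewrite scalar_mx_block; congr block_mx.
rewrite !trmx_mul trmxK !mulmxA WE' -(mulmxA E^T) WW mulmx1.
exact: col'_tr_mul.
Qed.

Lemma lyapunov_J_basis_change S D :
  lyapunov_J S D V *m basis_change W = basis_change W *m lyapunov_J S D U.
Proof.
rewrite /lyapunov_J row_mx01_col' !col'_mul !mulmx_block !mul0mx !mulmx0.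
rewrite !addr0 !add0r WE' !mulNmx !mulmxN; congr block_mx.
- by congr (- _); rewrite -(mulmxA _ E) EW !mulmxA WU -(mulmxA _ V) VW.
- by congr (- _); rewrite -(mulmxA _ V) VW !mulmxA WU.
Qed.

Lemma lyapunov_K_basis_change q (X : 'M[R]_(n.+1, q)) :
  lyapunov_K X V = basis_change W *m lyapunov_K X U.
Proof. by rewrite mul_block_col !mul0mx mulmx0 !add0r mulmxA WU. Qed.

Lemma lyapunov_C_basis_change q (Y : 'M[R]_(q, n.+1)) :
  lyapunov_C Y V *m basis_change W = lyapunov_C Y U.
Proof.
rewrite /lyapunov_C mul_row_block !mul0mx mulmx0 !addr0 !col'_mul.
by rewrite -(mulmxA _ E) EW !mulmxA -(mulmxA Y) VW.
Qed.

End Change.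

End OrthogonalBasis.

(** * Expansions of the arcsine and of the absolute value *)

Section Arcsine.
Context {R : realType}.

Lemma is_derive1_invsqrt (u : R) : -1 < u < 1 ->
  is_derive u 1 (fun u : R => (Num.sqrt (1 - u ^+ 2))^-1)
    (u * Num.sqrt (1 - u ^+ 2) ^- 3).
Proof.
move=> u1; have s0 : 0 < 1 - u ^+ 2 by move: u1 => /andP[]; nra.
have D1 : is_derive u 1 (fun u : R => 1 - u ^+ 2) (- (2 * u)).
  have := is_deriveB (is_derive_cst (1 : R) u (1 : R)) (is_deriveX 2 (is_derive_id u 1)).
  by move=> /is_derive_eq; apply; rewrite /GRing.scale /=; ring.
have D2 := is_derive1_comp (f := Num.sqrt) (g := fun u : R => 1 - u ^+ 2) (is_derive1_sqrt s0) D1.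
have r0 : Num.sqrt (1 - u ^+ 2) != 0 by rewrite sqrtr_eq0 -ltNge.
have := is_deriveV (f := fun u => Num.sqrt (1 - u ^+ 2)) r0 D2.
by move=> /is_derive_eq; apply; rewrite /GRing.scale /=; field.
Qed.

(** Meant for [a] the absolute value of a flow and [b] its one-sided slope along the ray. *)
Lemma expands2_asin (V : lmodType R) (g : V -> R) x v (a b : R) :
  -1 < a < 1 -> (\forall t \near 0^'+, g (x + t *: v) = asin (a + t * b)) ->
  g x = asin a ->
  expands2 g x v (b / Num.sqrt (1 - a ^+ 2))
    (2^-1 * (a * Num.sqrt (1 - a ^+ 2) ^- 3 * b ^+ 2)).
Proof.
move=> a1 gE gx.
have lineD (t : R) : is_derive t 1 (fun t => a + t * b) b.
  have := is_deriveD (is_derive_cst a t (1 : R)) (is_deriveZ b (is_derive_id t 1)).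
  rewrite (_ : _ + _ = fun t => a + t * b); last first.
    by apply/funext => s; rewrite !fctE /GRing.scale /= mulrC.
  by move=> /is_derive_eq; apply; rewrite /GRing.scale /=; ring.
have cv : a + t * b @[t --> (0 : R)] --> a.
  rewrite -[X in _ --> X]addr0 -[X in a + X](mul0r b).
  by apply: cvgD; [exact: cvg_cst|apply: cvgMl; exact: cvg_id].
have H := expands2_line (h := fun t => asin (a + t * b))
  (dh := fun t => b * (Num.sqrt (1 - (a + t * b) ^+ 2))^-1)
  (d2 := b * (a * Num.sqrt (1 - a ^+ 2) ^- 3 * b)) gE.
rewrite mul0r addr0 in H.
have -> : 2^-1 * (a * Num.sqrt (1 - a ^+ 2) ^- 3 * b ^+ 2) =
  b * (a * Num.sqrt (1 - a ^+ 2) ^- 3 * b) / 2 by ring.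
apply: H => //.
- have [al ar] := andP a1.
  near=> t; have t1 : -1 < a + t * b < 1.
    by apply/andP; split; near: t; [exact: (cvgr_gt _ cv)|exact: (cvgr_lt _ cv)].
  have := is_derive1_comp (f := @asin R) (g := fun t => a + t * b)
    (is_derive1_asin t1) (lineD t).
  by move=> /is_derive_eq; apply; rewrite mulrC.
- have a1' : -1 < a + 0 * b < 1 by rewrite mul0r addr0.
  have := is_deriveZ b (is_derive1_comp (g := fun t => a + t * b)
    (is_derive1_invsqrt a1') (lineD 0)).
  by move=> /is_derive_eq; apply; rewrite mul0r addr0.
Unshelve. all: by end_near. Qed.

Lemma powR_N32 (a : R) : 0 <= a -> a `^ (- (3 / 2)) = Num.sqrt a ^- 3.
Proof.
move=> a0; rewrite powRN mulrC powRrM powR12_sqrt //.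
by rewrite powR_mulrn // sqrtr_ge0.
Qed.

Lemma norm_line_right (a b : R) : a != 0 ->
  \forall t \near 0^'+, `|a + t * b| = `|a| + t * (Num.sg a * b).
Proof.
move=> a0.
have cv : a + t * b @[t --> (0 : R)^'+] --> a.
  rewrite -[X in _ --> X]addr0 -[X in a + X](mul0r b).
  apply: cvgD; first exact: cvg_cst.
  by apply: cvgMl; apply: cvg_within_filter; exact: cvg_id.
case: (ltgtP a 0) a0 => // [an|ap] _.
  near=> t; have ? : a + t * b < 0 by near: t; exact: (cvgr_lt _ cv).
  by rewrite !ltr0_norm // ltr0_sg //; ring.
near=> t; have ? : 0 < a + t * b by near: t; exact: (cvgr_gt _ cv).
by rewrite !gtr0_norm // gtr0_sg //; ring.
Unshelve. all: by end_near. Qed.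

End Arcsine.

(** * The kernel of the scaled Laplacian *)

Section Network.
Context {R : realType} {m nd nE : nat} (G : network R m nd nE).

Local Notation nV := (m.+2 + nd)%N.
Local Notation nV1 := (m.+1 + nd)%N.
Local Notation vec := 'cV[R]_m.+1.
Local Notation e0 := (delta_mx (ord0 : 'I_nV1.+1) 0 : 'cV[R]_nV).

Implicit Types (p v : vec) (k : 'I_nE).

Lemma incidence_tr_mul (u : 'cV[R]_nV) k :
  ((incidence G)^T *m u) k 0 = u (edge G k).1 0 - u (edge G k).2 0.
Proof.
rewrite mxE; under eq_bigr do rewrite !mxE mulrBl.
rewrite sumrB; congr (_ - _); [rewrite (bigD1 (edge G k).1) // | rewrite (bigD1 (edge G k).2) //];
  by rewrite /= eqxx mul1r big1 ?addr0 // => i /negPf ->; rewrite mul0r.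
Qed.

(** The hypothesis equates [u] at the two ends of each edge, and a path joining i to j propagates
    the equality. *)
Lemma incidence_tr_eq0 (u : 'cV[R]_nV) :
  (incidence G)^T *m u = 0 -> forall i j, u i 0 = u j 0.
Proof.
move=> u0 i j.
have adjE a b : adj G a b -> u a 0 = u b 0.
  move=> /(edge_enum) [k [ek _]].
  have := incidence_tr_mul u k; rewrite u0 mxE => /esym/eqP.
  by rewrite subr_eq0; case: ek => -> /= /eqP ->.
have /connectP[s] := adj_connected G i j.
elim: s i => [|a s IH] i /=; first by move=> _ ->.
by move=> /andP[/adjE -> ?] ?; exact: IH.
Qed.

(** The vector M^(1/2) 1: it is sent by M^(-1/2) to the all-ones vector, which the transposed
    incidence matrix annihilates. *)
Definition sqrt_mass : 'cV[R]_nV := \col_i Num.sqrt (mass G 0 i).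

(** The quadratic form at x is the sum of the squares of the entries of [z], weighted by w_k
    cos(asin(flow_k)), which is positive for flows below 1 in absolute value. Hence [z = 0], and
    connectedness makes [u] constant. The resulting line is the same for all p. *)
Lemma scaled_laplacian_kernel p (x : 'cV[R]_nV) :
  (forall k, `|flow G p k 0| < 1) -> scaled_laplacian G p *m x = 0 ->
  exists a, x = a *: sqrt_mass.
Proof.
move=> fl Sx; pose u := Mmx_isqrt G *m x; pose z := (incidence G)^T *m u.
have wc k : 0 < weight G 0 k * cos (asin (flow G p k 0)).
  rewrite mulr_gt0 ?weight_gt0 // cos_asin; last first.
    by have := fl k; rewrite ltr_norml => /andP[? ?]; apply/andP; split; exact: ltW.
  by rewrite sqrtr_gt0 subr_gt0 -real_normK ?num_real // expr_lt1.
have zE : \sum_k (weight G 0 k * cos (asin (flow G p k 0))) * z k 0 ^+ 2 = 0.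
  have : (x^T *m (scaled_laplacian G p *m x)) 0 0 = 0 by rewrite Sx mulmx0 mxE.
  have -> : x^T *m (scaled_laplacian G p *m x) = z^T *m (Wp G p *m z).
    by rewrite /z /u /scaled_laplacian !trmx_mul trmxK tr_diag_mx !mulmxA.
  rewrite /Wp /Wmx mulmx_diag mul_diag_mx mxE => {2}<-.
  by apply: eq_bigr => k _; rewrite !mxE; ring.
have z0 : z = 0.
  apply/matrixP => k j; rewrite ord1 [RHS]mxE.
  have zk_ge0 l : true -> 0 <= weight G 0 l * cos (asin (flow G p l 0)) * z l 0 ^+ 2.
    by move=> _; rewrite mulr_ge0 ?sqr_ge0 // ltW.
  have /eqP := psumr_eq0P zk_ge0 zE (i := k) isT.
  by rewrite mulf_eq0 (gt_eqF (wc k)) sqrf_eq0 /= => /eqP.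
have uE := incidence_tr_eq0 z0.
exists (u (ord0 : 'I_nV1.+1) 0); apply/matrixP => i j.
have ui : u i 0 = (Num.sqrt (mass G 0 i))^-1 * x i 0 by rewrite /u mul_diag_mx !mxE.
rewrite ord1 [RHS]mxE (uE _ i) ui mxE mulrAC mulVf ?mul1r //.
by rewrite sqrtr_eq0 -ltNge mass_gt0.
Qed.

(** A diagonal matrix with first entry 0 kills the first basis vector, and U is invertible: the
    first column of U spans the zero mode. *)
Lemma diagonalizes_kernel p (U : 'M[R]_nV) :
  diagonalizes G p U -> scaled_laplacian G p *m (U *m e0) = 0.
Proof.
move=> [UU Sdiag S0].
have UU' := mulmx1C UU.
suff Se0 : U^T *m scaled_laplacian G p *m U *m e0 = 0.
  rewrite -[LHS]mul1mx -UU' -[LHS]mulmxA.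
  have -> : U^T *m (scaled_laplacian G p *m (U *m e0)) = 0.
    by rewrite (mulmxA (scaled_laplacian G p)) 2!(mulmxA U^T).
  by rewrite mulmx0.
rewrite -colE; apply/matrixP => i j; rewrite [LHS]mxE [RHS]mxE.
have [->|i0] := eqVneq i (ord0 : 'I_nV1.+1); first exact: S0.
by apply: (is_diag_mxP Sdiag); rewrite -val_eqE in i0.
Qed.

(** The first columns of U and V both lie on the line of [sqrt_mass], and that of V is nonzero, so
    the former is a multiple of the latter. *)
Lemma diagonalizes_comm p y (U V : 'M[R]_nV) :
  (forall k, `|flow G p k 0| < 1) -> (forall k, `|flow G y k 0| < 1) ->
  diagonalizes G p V -> diagonalizes G y U ->
  exists c, (V^T *m U) *m e0 = c *: e0.
Proof.
move=> fp fy dV dU.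
have [a aE] := scaled_laplacian_kernel fp (diagonalizes_kernel dV).
have [b bE] := scaled_laplacian_kernel fy (diagonalizes_kernel dU).
have [VV _ _] := dV.
have e00 : e0 = a *: (V^T *m sqrt_mass) by rewrite scalemxAr -aE mulmxA VV mul1mx.
have a0 : a != 0.
  apply: contra_eq_neq e00 => ->; rewrite scale0r.
  by apply/eqP => /matrixP/(_ (ord0 : 'I_nV1.+1) 0)/eqP; rewrite !mxE !eqxx oner_eq0.
exists (b / a); rewrite -mulmxA bE e00 scalerA divfK //.
by rewrite -scalemxAr.
Qed.

End Network.

(** * Twice differentiability of the standard deviations *)

Section StandardDeviation.
Context {R : realType} {m nd nE : nat} (G : network R m nd nE).

Local Notation nV := (m.+2 + nd)%N.
Local Notation nV1 := (m.+1 + nd)%N.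
Local Notation vec := 'cV[R]_m.+1.

Implicit Types (p v : vec) (k : 'I_nE).

Lemma JdE p (U : 'M[R]_nV) :
  Jd G p U = lyapunov_J (n := nV1) (scaled_laplacian G p) (invmx (Mmx G) *m Dmx G) U.
Proof. by rewrite /Jd /lyapunov_J [in RHS](mulmxA U^T (invmx (Mmx G))). Qed.

Lemma KdE (U : 'M[R]_nV) :
  Kd G U = lyapunov_K (n := nV1) (Mmx_isqrt G *m K2mx G) U.
Proof. by rewrite /Kd /lyapunov_K (mulmxA U^T (Mmx_isqrt G)). Qed.

Lemma CdE (U : 'M[R]_nV) :
  Cd G U = lyapunov_C (n := nV1) ((incidence G)^T *m Mmx_isqrt G) U.
Proof. by []. Qed.

Lemma differentiable2_flow p k : differentiable2 (fun y => flow G y k 0) p.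
Proof.
under [fun _ => _]funext do rewrite mxE.
apply: differentiable2D; last exact: differentiable2_cst.
apply: (mx_differentiable2M (A := fun=> Amx G) (B := id)).
  exact: mx_differentiable2_cst.
by move=> i j; rewrite ord1; exact: differentiable2_coord.
Qed.

Lemma near_flow_lt1 p : (forall k, `|flow G p k 0| < 1) ->
  \forall y \near p, forall k, `|flow G y k 0| < 1.
Proof.
move=> fl; apply: (filter_forall (F := nbhs p)) => k.
have cf : flow G y k 0 @[y --> p] --> flow G p k 0.
  exact: differentiable2_continuous (differentiable2_flow p k).
have cn : `|flow G y k 0| @[y --> p] --> `|flow G p k 0| by exact: cvg_norm cf.
exact: (cvgr_lt _ cn).
Qed.

Lemma mx_differentiable2_scaled_laplacian p : (forall k, `|flow G p k 0| < 1) ->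
  mx_differentiable2 (scaled_laplacian G) p.
Proof.
move=> fl; rewrite /scaled_laplacian.
do 2!(apply: mx_differentiable2M; last exact: mx_differentiable2_cst).
apply: mx_differentiable2M; first exact: mx_differentiable2_cst.
apply: mx_differentiable2M; first exact: mx_differentiable2_cst.
apply: mx_differentiable2_diag => i k; under [fun _ => _]funext do rewrite mxE.
(* Here cos(asin x) is replaced by the square root of 1 - x^2, legitimate near p and smooth because
   the radicand is positive. *)
apply: (near_differentiable2 (f := fun y => Num.sqrt (1 - flow G y k 0 ^+ 2))).
  apply: filterS (near_flow_lt1 fl) => y /(_ k) fy; rewrite cos_asin //.
  by move: fy; rewrite ltr_norml => /andP[? ?]; apply/andP; split; exact: ltW.
have dfl := differentiable2_flow p k.
apply: differentiable2_sqrt.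
  by rewrite subr_gt0 -real_normK ?num_real // expr_lt1.
rewrite (_ : (fun y => _) = cst 1 + cst (- 1) *
    ((fun y => flow G y k 0) * (fun y => flow G y k 0))); last first.
  by apply/funext => y; rewrite !fctE mulN1r expr2.
apply: differentiable2D; first exact: differentiable2_cst.
by apply: differentiable2M; [exact: differentiable2_cst|exact: differentiable2M].
Qed.

Lemma mx_differentiable2_Jd p (V : 'M[R]_nV) : (forall k, `|flow G p k 0| < 1) ->
  mx_differentiable2 (fun y => Jd G y V) p.
Proof.
move=> fl; under [fun _ => _]funext do rewrite JdE /lyapunov_J.
apply: mx_differentiable2_col_mx; first exact: mx_differentiable2_cst.
apply: mx_differentiable2_row_mx; last exact: mx_differentiable2_cst.
under [fun _ => _]funext do rewrite col'_mul.
apply: mx_differentiable2N.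
do 2!(apply: mx_differentiable2M; last exact: mx_differentiable2_cst).
apply: mx_differentiable2M; first exact: mx_differentiable2_cst.
exact: mx_differentiable2_scaled_laplacian.
Qed.

Lemma mx_differentiable2_lyapunov_mx n (J : vec -> 'M[R]_n) p :
  mx_differentiable2 J p -> mx_differentiable2 (fun y => lyapunov_mx (J y)) p.
Proof.
move=> dJ; apply: mx_differentiable2D; first exact: mx_differentiable2_lin_mulmx.
by apply: mx_differentiable2_lin_mulmxr; exact: mx_differentiable2_tr.
Qed.

Lemma mx_differentiable2_lyapunov_sol n q (J : vec -> 'M[R]_n) (K : 'M[R]_(n, q)) p :
  mx_differentiable2 J p -> lyapunov_mx (J p) \in unitmx ->
  mx_differentiable2 (fun y => lyapunov_sol (J y) K) p.
Proof.
move=> dJ Ju; apply: mx_differentiable2_vec_mx.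
apply: mx_differentiable2M; first exact: mx_differentiable2_cst.
apply: (mx_differentiable2_inv (A := fun y => lyapunov_mx (J y))) => //.
exact: mx_differentiable2_lyapunov_mx.
Qed.

(* The variance does not depend on the choice of the diagonalizing matrix, which
   may vary discontinuously with the point: any U agrees with a fixed V. *)
Lemma variance_basis_change p y (U V : 'M[R]_nV) :
  (forall k, `|flow G p k 0| < 1) -> (forall k, `|flow G y k 0| < 1) ->
  diagonalizes G p V -> diagonalizes G y U ->
  lyapunov_mx (Jd G y V) \in unitmx ->
  Cd G U *m Qx G y U *m (Cd G U)^T =
  Cd G V *m lyapunov_sol (Jd G y V) (Kd G V) *m (Cd G V)^T.
Proof.
move=> fp fy dV dU Ju.
have [[UU _ _] [VV _ _]] := (dU, dV).
pose W : 'M[R]_nV1.+1 := V^T *m U.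
have VW : V *m W = U by rewrite mulmxA (mulmx1C VV) mul1mx.
have [c Wc] := diagonalizes_comm fp fy dV dU.
have [d] := diagonalizes_comm fy fp dU dV.
rewrite -[U^T *m V]trmxK trmx_mul trmxK => Wd.
have WE := col'_mul_tr_comm Wc Wd.
pose T := basis_change W.
have TT : T *m T^T = 1%:M := basis_change_orthogonal UU VV VW WE.
have TT' := mulmx1C TT.
have JT : Jd G y V *m T = T *m Jd G y U.
  by rewrite !JdE; exact: lyapunov_J_basis_change.
have KT : Kd G V = T *m Kd G U by rewrite !KdE; exact: lyapunov_K_basis_change.
have CT : Cd G V *m T = Cd G U by rewrite !CdE; exact: lyapunov_C_basis_change.
have QU : Jd G y U *m Qx G y U + Qx G y U *m (Jd G y U)^T + Kd G U *m (Kd G U)^T = 0.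
  have JT' : Jd G y U *m T^T = T^T *m Jd G y V.
    by rewrite -[LHS]mul1mx -TT' -mulmxA (mulmxA T) -JT -!mulmxA TT mulmx1.
  have KT' : Kd G U = T^T *m Kd G V by rewrite KT mulmxA TT' mul1mx.
  (* [Qx] is a choice with default 0, so some solution must be shown to exist: the one for V,
     conjugated back by T^T. *)
  rewrite /Qx; case: xgetP => [Q _ //|/(_ (T^T *m lyapunov_sol (Jd G y V) (Kd G V) *m T))].
  case; rewrite /= -{2 4}[T]trmxK.
  apply: lyapunov_orthogonal_conj JT' KT' _; first by rewrite trmxK.
  exact/lyapunov_solP.
have /lyapunov_solP - /(_ Ju) <- := lyapunov_orthogonal_conj TT JT KT QU.
by rewrite -CT trmx_mul !mulmxA.
Qed.

(** With the basis frozen at V = U(p), [sigma] agrees near p with the square root of an entry of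
    [Cov], in which only [Jd G y V] varies. Openness of O provides diagonalizing matrices at the
    nearby points. *)
Lemma sigma_differentiable2 (O : set vec) (U : vec -> 'M[R]_nV) p k :
  open O -> O p -> (forall y, O y -> diagonalizes G y (U y)) ->
  (forall l, `|flow G p l 0| < 1) -> hurwitz (Jd G p (U p)) ->
  0 < sigma G U k p -> differentiable2 (sigma G U k) p.
Proof.
move=> oO Op dU fl; have := dU p Op; set V := U p => dV hJ.
have dJ := mx_differentiable2_Jd V fl.
have Ju : lyapunov_mx (Jd G p V) \in unitmx by exact: hurwitz_lyapunov_unitmx.
have nJu : \forall y \near p, lyapunov_mx (Jd G y V) \in unitmx.
  exact: (near_unitmx (mx_differentiable2_lyapunov_mx dJ) Ju).
pose Cov y := Cd G V *m lyapunov_sol (Jd G y V) (Kd G V) *m (Cd G V)^T.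
have dCov : mx_differentiable2 Cov p.
  apply: mx_differentiable2M; last exact: mx_differentiable2_cst.
  apply: mx_differentiable2M; first exact: mx_differentiable2_cst.
  exact: mx_differentiable2_lyapunov_sol.
have sigmaE : {near p, (fun y => Num.sqrt (Cov y k k)) =1 sigma G U k}.
  near=> y; rewrite /sigma /Cov.
  have fy : forall l, `|flow G y l 0| < 1 by near: y; exact: near_flow_lt1.
  have dUy : diagonalizes G y (U y).
    by apply: dU; near: y; exact: open_nbhs_nbhs.
  have Juy : lyapunov_mx (Jd G y V) \in unitmx by near: y; exact: nJu.
  by rewrite (variance_basis_change fl fy dV dUy Juy).
rewrite -(nbhs_singleton sigmaE) sqrtr_gt0 => Cov0.
apply: near_differentiable2 sigmaE _.
exact: differentiable2_sqrt.
Unshelve. all: by end_near. Qed.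

End StandardDeviation.

(** * Expansions of the functions f_k *)

Section Objective.
Context {R : realType} {m nd nE : nat} (G : network R m nd nE).
Implicit Types (p v : 'cV[R]_m.+1) (k : 'I_nE).

Lemma flow_line p v t k :
  flow G (p + t *: v) k 0 = flow G p k 0 + t * (row k (Amx G) *m v) 0 0.
Proof.
rewrite -row_mul mxE /flow mulmxDr -scalemxAr !mxE.
by rewrite addrAC.
Qed.

Lemma f_as_expands2 p v k : `|flow G p k 0| < 1 ->
  exists c, expands2 (f_as G k) p v c
    (2^-1 * ((1 - flow G p k 0 ^+ 2) `^ (- (3 / 2)) * `|flow G p k 0|
      * (v^T *m (row k (Amx G))^T *m row k (Amx G) *m v) 0 0)).
Proof.
move=> fl; set a := flow G p k 0; set w := (row k (Amx G) *m v) 0 0.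
have -> : (v^T *m (row k (Amx G))^T *m row k (Amx G) *m v) 0 0 = w ^+ 2.
  rewrite -trmx_mul -mulmxA mxE big_ord1 expr2; congr (_ * _).
  by rewrite mxE.
have fl2 : 0 <= 1 - a ^+ 2.
  by rewrite subr_ge0 -real_normK ?num_real // expr_le1 // ltW.
have fl1 : -1 < `|a| < 1 by rewrite fl andbT (lt_le_trans _ (normr_ge0 a)) ?ltrN10.
rewrite powR_N32 // -(real_normK (num_real a)).
(* [b] is the one-sided slope of |a + t w| at 0: sg(a) w if a is nonzero, |w| if a = 0. Since |a|
   b^2 = |a| w^2 either way, one quadratic coefficient serves both cases. *)
have [b [bw bE]] : exists b, `|a| * b ^+ 2 = `|a| * w ^+ 2 /\
    \forall t \near 0^'+, `|a + t * w| = `|a| + t * b.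
  have [a0|a0] := eqVneq a 0.
    exists `|w|; rewrite a0 normr0 !mul0r; split => //; near=> t.
    have t0 : 0 < t by near: t; exact: nbhs_right_gt.
    by rewrite !add0r normrM (gtr0_norm t0).
  exists (Num.sg a * w); split; last exact: norm_line_right.
  by rewrite exprMn sqr_sg a0 mul1r.
exists (b / Num.sqrt (1 - `|a| ^+ 2)).
have -> : Num.sqrt (1 - `|a| ^+ 2) ^- 3 * `|a| * w ^+ 2 =
    `|a| * Num.sqrt (1 - `|a| ^+ 2) ^- 3 * b ^+ 2.
  by rewrite [RHS]mulrAC bw; ring.
apply: expands2_asin => //; near=> t.
rewrite /f_as flow_line; congr asin.
by near: t.
Unshelve. all: by end_near. Qed.

(** The linear coefficient stays existential, since it is recovered later as [dderiv1]; [d2_nonzero]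
    also covers zero flow, where its arcsine term vanishes. *)
Lemma f_expands2 (U : 'cV[R]_m.+1 -> 'M[R]_(m.+2 + nd)) (r : R) p v k :
  `|flow G p k 0| < 1 -> differentiable2 (sigma G U k) p ->
  exists c, expands2 (f_ G U r k) p v c (2^-1 * d2_nonzero G U r k p v).
Proof.
move=> fl ds; have [c fE] := f_as_expands2 v fl.
exists (c + r * 'D_v (sigma G U k) p).
rewrite /d2_nonzero -derive2_hessian // mulrDr.
apply: expands2D => //; rewrite mulrCA [2^-1 * _]mulrC.
by apply: expands2Z; exact: differentiable2_expands2.
Qed.

Lemma d2_nonzero_flow0 (U : 'cV[R]_m.+1 -> 'M[R]_(m.+2 + nd)) (r : R) p v k :
  flow G p k 0 = 0 -> d2_nonzero G U r k p v = d2_zero G U r k p v.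
Proof. by move=> f0; rewrite /d2_nonzero f0 normr0 mulr0 mul0r add0r. Qed.

End Objective.

(** * The second directional derivative of the objective *)

Theorem proposition4p9 (R : realType) (m nd nE : nat) (G : network R m nd nE)
    (r : R) (r_gt0 : 0 < r)
    (flow_lt1 : forall p, Pplus G p -> forall k, `|flow G p k 0| < 1)
    (O : set 'cV[R]_m.+1) (O_open : open O) (PO : Pplus G `<=` O)
    (U : 'cV[R]_m.+1 -> 'M[R]_(m.+2 + nd))
    (U_diag : forall p, O p -> diagonalizes G p (U p))
    (J_hurwitz : forall p, Pplus G p -> hurwitz (Jd G p (U p)))
    (sigma_gt0 : forall p, Pplus G p -> forall k, 0 < sigma G U k p)
    (p v : 'cV[R]_m.+1) (Pp : Pplus G p) (Ppv : Pplus G (p + v)) :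
  [/\ forall k, has_hessian (sigma G U k) p,
      forall k, Imax G U r p = [set k]%SET -> flow G p k 0 != 0 ->
        [/\ has_dderiv2 (fobj G U r) p v,
            has_dderiv2 (f_ G U r k) p v,
            dderiv2 (fobj G U r) p v = dderiv2 (f_ G U r k) p v
          & dderiv2 (f_ G U r k) p v = d2_nonzero G U r k p v],
      forall k, Imax G U r p = [set k]%SET -> flow G p k 0 = 0 ->
        [/\ has_dderiv2 (fobj G U r) p v,
            has_dderiv2 (f_ G U r k) p v,
            dderiv2 (fobj G U r) p v = dderiv2 (f_ G U r k) p v
          & dderiv2 (f_ G U r k) p v = d2_zero G U r k p v]
    & (2 <= #|Imax G U r p|)%N ->
        [/\ has_dderiv2 (fobj G U r) p v,
            (forall k, k \in Imax G U r p -> has_dderiv1 (f_ G U r k) p v),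
            (exists k, k \in Imax_dir G U r p v),
            (forall k, k \in Imax_dir G U r p v ->
              [/\ has_dderiv2 (f_ G U r k) p v,
                  flow G p k 0 != 0 ->
                    dderiv2 (f_ G U r k) p v = d2_nonzero G U r k p v
                & flow G p k 0 = 0 ->
                    dderiv2 (f_ G U r k) p v = d2_zero G U r k p v])
          & 2^-1 * dderiv2 (fobj G U r) p v =
            2^-1 * finmax (Imax_dir G U r p v)
                     (fun k => dderiv2 (f_ G U r k) p v)]].
Proof.
have ds k : differentiable2 (sigma G U k) p.
  by apply: sigma_differentiable2 (PO _ Pp) _ _ _ _ => //; auto.
have d2E k : 2 * (2^-1 * d2_nonzero G U r k p v) = d2_nonzero G U r k p v.
  by rewrite mulrA mulfV ?mul1r // pnatr_eq0.
have /choice[c fE] k := f_expands2 r v (flow_lt1 p Pp k) (ds k).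
have fd1 k : has_dderiv1 (f_ G U r k) p v /\ dderiv1 (f_ G U r k) p v = c k.
  exact: expands2_dderiv1 (fE k).
have fd2 k : has_dderiv2 (f_ G U r k) p v /\
    dderiv2 (f_ G U r k) p v = d2_nonzero G U r k p v.
  by have := expands2_dderiv2 (fE k); rewrite d2E.
pose I := Imax G U r p; pose J := Imax_dir G U r p v.
have maxE k0 : k0 \in I -> (exists k, k \in J) /\
    expands2 (fobj G U r) p v (finmax I c)
      (finmax J (fun k => 2^-1 * d2_nonzero G U r k p v)).
  move=> k0I; have [exJ fobjE] := expands2_finmax k0I fE.
  (* [Imax_dir] is defined through [dderiv1] of the objective; the expansion just obtained shows
     that this derivative is [finmax I c], which identifies the two index sets. *)
  suff -> : J = [set k in I | c k == finmax I c]%SET by [].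
  have [_ d1E] := expands2_dderiv1 fobjE.
  apply/setP => k; rewrite !inE; congr (_ && _).
  by rewrite d1E (fd1 k).2 eq_sym.
have fobj2 k0 : k0 \in I -> has_dderiv2 (fobj G U r) p v /\
    dderiv2 (fobj G U r) p v = finmax J (fun k => d2_nonzero G U r k p v).
  move=> /maxE[_ /expands2_dderiv2[? ->]]; split => //.
  by rewrite -finmaxM //; apply: eq_finmax => k _; rewrite d2E.
have single k : I = [set k]%SET -> [/\ has_dderiv2 (fobj G U r) p v,
    has_dderiv2 (f_ G U r k) p v,
    dderiv2 (fobj G U r) p v = dderiv2 (f_ G U r k) p v
  & dderiv2 (f_ G U r k) p v = d2_nonzero G U r k p v].
  move=> Ik; have kI : k \in I by rewrite Ik finset.in_set1.
  have [has2 ->] := fobj2 k kI; have [fk2 fk2E] := fd2 k.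
  split => //; rewrite fk2E.
  (* [J] is nonempty and contained in the singleton {k}, so its maximum is the value at k. *)
  have [[k' k'J] _] := maxE k kI.
  have [k'' + ->] := finmax_attained (fun k => d2_nonzero G U r k p v) k'J.
  by rewrite inE -/I Ik => /andP[/set1P-> _].
split.
- by move=> k; exact: differentiable2_has_hessian.
- by move=> k Ik _; exact: single.
- by move=> k Ik f0; rewrite -(d2_nonzero_flow0 _ _ _ f0); exact: single.
move=> I2; have [k0 k0I] : exists k0, k0 \in I.
  by apply/set0Pn; rewrite -finset.card_gt0 (leq_trans _ I2).
have [has2 fobj2E] := fobj2 k0 k0I.
split => //.
- by move=> k _; exact: (fd1 k).1.
- exact: (maxE k0 k0I).1.
- move=> k _; split; [exact: (fd2 k).1 | by rewrite (fd2 k).2 | ].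
  by move=> f0; rewrite (fd2 k).2 (d2_nonzero_flow0 _ _ _ f0).
- rewrite fobj2E; congr (_ * _); apply: eq_finmax => k _.
  by rewrite (fd2 k).2.
Qed.
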